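(* Let $X=M+A$ be a càdlàg stochastic process. Then the following are equivalent: (1) $X$ is of class $(\Sigma^{r})$; (2) there exist a continuous finite variation process $C$ and a càdlàg predictable process $V$ (of finite variation) such that $A=C+V$ and, for all $t\ge0$, $$\int_{0}^{t}1_{\{X_{s}\neq0\}}dC_{s}=\int_{0}^{t}1_{\{X_{s-}\neq0\}}dV_{s}=0.$$
   Context: Fix a filtered probability space $(\Omega,\mathcal{F},(\mathcal{F}_{t})_{t\geq0},\mathbf{P})$ satisfying the usual conditions. Writing a process as $X=M+A$ means that $M$ is a càdlàg local martingale with $M_0=0$ and $A$ is an adapted càdlàg predictable process of finite variation with $A_{0-}=A_0=0$. $X_{t-}$ is the left limit of $X$ at $t>0$ and $X_{0-}=X_0$. Integrals with respect to $dA$, $dC$, $dV$ are Lebesgue–Stieltjes integrals. Class $(\Sigma^{r})$: $X$ is of class $(\Sigma^{r})$ if it decomposes as $X=M+A$ with $M$ a càdlàg local martingale, $M_0=0$; $A$ an adapted càdlàg predictable process of finite variation with $A_{0-}=A_0=0$; and $\int_{0}^{t}1_{\{X_{s-}\neq0\}}dA_{s}=0$ for all $t\geq0$. *)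

(* Defs.v *)
From HB Require Import structures.
From mathcomp Require Import all_boot all_order all_algebra.
From mathcomp Require Import all_classical all_reals all_analysis.

Set Implicit Arguments.
Unset Strict Implicit.
Unset Printing Implicit Defensive.

Import Order.TTheory GRing.Theory Num.Theory.
Import numFieldNormedType.Exports.

Local Open Scope classical_set_scope.
Local Open Scope ring_scope.

(* Time is [0, +oo[, encoded as the nonnegative part of R: a path is a function
   R -> R and a process a function R -> T -> R, and their values at negative
   times never matter. *)

Section paths.
Context {R : realType}.
Implicit Types (x g : R -> R) (t : R).

Definition cadlag_path x : Prop :=
  (forall t, 0 <= t -> x s @[s --> t^'+] --> x t) /\
  (forall t, 0 < t -> cvg (x s @[s --> t^'-])).

Definition continuous_path x : Prop := {within `[0, +oo[, continuous x}.

Definition finite_variation_path x : Prop :=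
  forall t, 0 <= t -> bounded_variation 0 t x.

(* x_{t-}, with the convention x_{0-} = x_0. *)
Definition left_limit x t : R :=
  if 0 < t then lim (x s @[s --> t^'-]) else x 0.

End paths.

Section stieltjes_integral.
Context {R : realType}.

Definition cumulative_fun (f : R -> R)
  (_ : nondecreasing f /\ right_continuous f) : R -> R := f.

HB.instance Definition _ (f : R -> R)
    (h : nondecreasing f /\ right_continuous f) :=
  isCumulative.Build R _ R (cumulative_fun h) (proj1 h) (proj2 h).

(* Null measure by default, if f is not a cumulative function. *)
Definition stieltjes_measure (f : R -> R) :
    {measure set (measurableTypeR R) -> \bar R} :=
  match pselect (nondecreasing f /\ right_continuous f) with
  | left h => lebesgue_stieltjes_measure (cumulative_fun h)
  | right _ => mzero
  end.

(* The two terms of the Jordan decomposition x = x^+ - x^- on [0, +oo[, extended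
   by constants to the negative half-line. *)
Definition pos_part_path (x : R -> R) : R -> R :=
  fun t => fine (pos_tv 0 x (Num.max 0 t)).
Definition neg_part_path (x : R -> R) : R -> R :=
  fun t => fine (neg_tv 0 x (Num.max 0 t)).

(* \int_0^t g dx, over ]0, t]: by the convention x_{0-} = x_0, dx has no mass
   at 0. *)
Definition stieltjes_integral (g x : R -> R) (t : R) : R :=
  \int[stieltjes_measure (pos_part_path x)]_(s in `]0, t]) g s -
  \int[stieltjes_measure (neg_part_path x)]_(s in `]0, t]) g s.

(* For right-continuous paths of finite variation, the default value in
   stieltjes_measure is thus never used. *)
Lemma neg_part_path_cumulative (x : R -> R) :
  (forall t, 0 <= t -> x s @[s --> t^'+] --> x t) ->
  finite_variation_path x ->
  nondecreasing (neg_part_path x) /\ right_continuous (neg_part_path x).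
Proof.
move=> xrc xfv; split.
  move=> s t st; rewrite /neg_part_path.
  have m0 (u : R) : 0 <= Num.max 0 u by rewrite le_max lexx.
  have mst : Num.max 0 s <= Num.max 0 t by rewrite ge_max m0 le_max st orbT.
  apply: (fine_neg_tv_nondecreasing (xfv _ (m0 t))) => //.
  - by rewrite in_itv/= m0.
  - by rewrite in_itv/= m0 lexx.
move=> t; have [t0|t0] := leP 0 t.
  have -> : neg_part_path x t = fine (neg_tv 0 x t).
    by rewrite /neg_part_path max_r.
  have t1 : 0 <= t + 1 by rewrite addr_ge0.
  have tt1 : t < t + 1 by rewrite ltrDl.
  apply: cvg_trans (neg_tv_right_continuous t0 tt1 (xfv _ t1) (xrc _ t0)).
  apply: near_eq_cvg; near=> s.
  have ts : t <= s by near: s; exact: nbhs_right_ge.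
  by rewrite /neg_part_path /= max_r// (le_trans t0).
have -> : neg_part_path x t = fine (neg_tv 0 x 0).
  by rewrite /neg_part_path max_l// ltW.
apply: cvg_near_cst; near=> s.
have s0 : s < 0 by near: s; exact: nbhs_right_lt.
by rewrite /neg_part_path max_l// ltW.
Unshelve. all: by end_near. Qed.

Lemma pos_part_path_cumulative (x : R -> R) :
  (forall t, 0 <= t -> x s @[s --> t^'+] --> x t) ->
  finite_variation_path x ->
  nondecreasing (pos_part_path x) /\ right_continuous (pos_part_path x).
Proof.
move=> xrc xfv; apply: (@neg_part_path_cumulative (\- x)).
  by move=> t t0; apply: cvgN; exact: xrc.
by move=> t t0; exact: bounded_variationN (xfv t t0).
Qed.

End stieltjes_integral.

Section stochastic_basis.
Context {d : measure_display} {T : measurableType d} {R : realType}.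
Variable P : probability T R.
Implicit Types (F : R -> set (set T)) (X M A : R -> T -> R).

Record usual_conditions F : Prop := {
  filtration_sigma_algebra : forall t, 0 <= t -> sigma_algebra setT (F t) ;
  filtration_measurable : forall t, 0 <= t -> F t `<=` measurable ;
  filtration_nondecreasing :
    forall s t, 0 <= s -> s <= t -> F s `<=` F t ;
  filtration_right_continuous :
    forall t, 0 <= t -> F t = \bigcap_(s in [set s | t < s]) F s ;
  (* P.-negligible sets are the subsets of measurable P-null sets, so this also
     says that the ambient sigma-algebra is P-complete. *)
  filtration_complete : forall N, P.-negligible N -> F 0 N }.

Definition measurable_wrt (G : set (set T)) (Y : T -> R) : Prop :=
  forall B : set R, measurable B -> G (Y @^-1` B).

Definition adapted F X : Prop := forall t, 0 <= t -> measurable_wrt (F t) (X t).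

(* Generators of the predictable sigma-algebra on [0, +oo[ x T. *)
Definition predictable_rectangle F : set (set (R * T)) :=
  [set Q | exists2 E, F 0 E & Q = [set 0] `*` E] `|`
  [set Q | exists s t E,
    [/\ 0 <= s, s <= t, F s E & Q = `]s, t] `*` E]].

Definition predictable F X : Prop :=
  let D : set (R * T) := `[0, +oo[ `*` setT in
  forall B : set R, measurable B ->
    <<s D, predictable_rectangle F>>
      (D `&` (fun p => X p.1 p.2) @^-1` B).

(* Y is a version of the conditional expectation of Z given G. *)
Definition is_conditional_expectation (G : set (set T)) (Z Y : T -> R) : Prop :=
  [/\ measurable_wrt G Y,
      P.-integrable setT (EFin \o Y) &
      forall E, G E -> (\int[P]_(w in E) (Y w)%:E = \int[P]_(w in E) (Z w)%:E)%E].

Definition martingale F X : Prop :=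
  [/\ adapted F X,
      forall t, 0 <= t -> P.-integrable setT (EFin \o X t) &
      forall s t, 0 <= s -> s <= t ->
        is_conditional_expectation (F s) (X t) (X s)].

Definition stopping_time F (tau : T -> \bar R) : Prop :=
  (forall w, (0 <= tau w)%E) /\
  (forall t, 0 <= t -> F t [set w | (tau w <= t%:E)%E]).

Definition stopped X (tau : T -> \bar R) : R -> T -> R :=
  fun t w => X (fine (Order.min t%:E (tau w))) w.

Definition cadlag X : Prop := \forall w \ae P, cadlag_path (X ^~ w).

Definition continuous_process X : Prop :=
  \forall w \ae P, continuous_path (X ^~ w).

Definition finite_variation X : Prop :=
  \forall w \ae P, finite_variation_path (X ^~ w).

Definition cadlag_local_martingale F M : Prop :=
  [/\ adapted F M, cadlag M &
      exists tau : nat -> T -> \bar R,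
        [/\ forall n, stopping_time F (tau n),
            \forall w \ae P, {homo (tau ^~ w) : m n / (m <= n)%N >-> (m <= n)%E},
            \forall w \ae P, tau n w @[n --> \oo] --> +oo%E &
            forall n, martingale F (stopped (fun t w => M t w - M 0 w) (tau n))]].

(* The meaning of "X = M + A". *)
Record decomposition F X M A : Prop := {
  decomposition_eq :
    \forall w \ae P, forall t, 0 <= t -> X t w = M t w + A t w ;
  decomposition_M : cadlag_local_martingale F M ;
  decomposition_M0 : \forall w \ae P, M 0 w = 0 ;
  decomposition_A_adapted : adapted F A ;
  decomposition_A_cadlag : cadlag A ;
  decomposition_A_predictable : predictable F A ;
  decomposition_A_fv : finite_variation A ;
  decomposition_A0 : \forall w \ae P, left_limit (A ^~ w) 0 = A 0 w /\ A 0 w = 0 }.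

Definition class_Sigma_r F X : Prop :=
  exists M A, decomposition F X M A /\
    \forall w \ae P, forall t, 0 <= t ->
      stieltjes_integral \1_[set s | left_limit (X ^~ w) s != 0] (A ^~ w) t = 0.

End stochastic_basis.

(* Main.v *)
Require Import Defs.
From mathcomp Require Import all_boot all_order all_algebra.
From mathcomp Require Import all_classical all_reals all_analysis.
From mathcomp Require Import measurable_realfun.
From mathcomp Require Import ring lra.

(** From (2) to (1): for a fixed Borel set S the integral of 1_S with respect to
    dx is additive in the right-continuous path x of finite variation
    ([stieltjes_integral_indicD]), so the integral of 1_{X_- <> 0} against dA is
    the sum of those against dC and dV.  The second vanishes by assumption.  The
    sets {X_- <> 0} and {X <> 0} differ only at jump times of X, which are
    countably many, and dC has no atoms; so the first equals the integral of
    1_{X <> 0} against dC, which vanishes too ([stieltjes_integral_left_limit]).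

    From (1) to (2): take C = 0 and V = A.  The condition in (1) bears on the
    predictable part A' of some decomposition X = M' + A', the one in (2) on the
    given A; so what has to be proved is that the decomposition is unique
    ([decomposition_unique]).  The difference N = A' - A = M - M' is a
    predictable process of finite variation and a local martingale null at 0,
    and such a process vanishes ([predictable_finite_variation_null]).

    The reason is the following.  Let V be the total variation of N and stop all
    processes when V passes a level k; the overshoot is controlled by the stopped
    N, so the stopped V is integrable ([variation_overshoot]).  Both V and
    U = V - N are nondecreasing, and optional stopping says that the measures
    dV dP and dU dP on [0, t] x T give the same mass to every predictable
    rectangle; hence they integrate every predictable function alike.  Let
    f(y) = y^2 / (1 + y^2), so that f(b) - f(a) = h(a, b) (b - a) with h bounded
    and Lipschitz in b.  Over a grid g_0 < ... < g_{n+1} of [0, t],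
      E f(N_t) = sum_k E h(N_{g_k}, N_{g_{k+1}}) (N_{g_{k+1}} - N_{g_k}).
    Write N = V - U.  As the grid gets finer, N_{g_{k+1}} can be replaced by N_s
    with s in ]g_k, g_{k+1}], because N is right-continuous
    ([chain_rule_approximation]).  After this replacement the integrand
    h(N_{g_k}, N_s) is predictable, the integrals against dV dP and dU dP cancel,
    and E f(N_t) = 0 ([stopped_null]).

    The measure dV dP is handled as the image of P x Lebesgue under the time
    change (w, u) |-> (inf {r | V_r(w) >= u}, w), which reduces integration with
    respect to a random measure to Fubini's theorem on a product space.

    Optional stopping itself ([optional_stopping]) is obtained by rounding the
    stopping time up to a grid.  To pass to the limit, y is cut into its
    truncation to [-K, K] and the rest, of absolute value max(|y| - K, 0), which
    is convex in y: so its mean at the stopping time is at most its mean at the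
    final time, which tends to 0 with K -> oo. *)

Import Order.TTheory GRing.Theory Num.Theory.
Import numFieldNormedType.Exports.
Local Open Scope classical_set_scope.
Local Open Scope ring_scope.
Set Implicit Arguments.
Unset Strict Implicit.
Unset Printing Implicit Defensive.

(** * Stieltjes integrals of indicators *)

(** This is m1 - n1 = (n2 - m2) + (n3 - m3), written without subtraction so that
    infinite masses are allowed. *)
Lemma measure_sum3_unique d (T : measurableType d) (R : realType)
    (G : set (set T)) (g : (set T)^nat)
    (m1 m2 m3 n1 n2 n3 : {measure set T -> \bar R}) :
  measurable = <<s G >> -> setI_closed G -> (forall k, G (g k)) ->
  \bigcup_k g k = setT ->
  (forall A, G A -> m1 A + m2 A + m3 A = n1 A + n2 A + n3 A)%E ->
  (forall k, m1 (g k) + m2 (g k) + m3 (g k) < +oo)%E ->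
  forall A, measurable A -> (m1 A + m2 A + m3 A = n1 A + n2 A + n3 A)%E.
Proof.
move=> mG GI Gg gT mn mfin A mA.
have sumE (p1 p2 p3 : {measure set T -> \bar R}) B :
    measure_add (measure_add p1 p2) p3 B = (p1 B + p2 B + p3 B)%E.
  by etransitivity; [exact: measure_addE|congr (_ + _)%E; exact: measure_addE].
rewrite -!sumE; apply: (measure_unique G g) => //.
- move=> B GB; transitivity (m1 B + m2 B + m3 B)%E; first exact: sumE.
  by rewrite mn//; apply/esym; exact: sumE.
- by move=> k; apply: le_lt_trans (mfin k); rewrite -sumE.
Qed.

Section path_integrals.
Context {R : realType}.
Implicit Types (x y g : R -> R) (s t : R).

Lemma eq_total_variation t x y :
  (forall s, 0 <= s -> x s = y s) -> total_variation 0 t x = total_variation 0 t y.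
Proof.
move=> xy; suff xyv l : itv_partition 0 t l -> variation 0 t x l = variation 0 t y l.
  rewrite /total_variation; congr (ereal_sup (_ @` _)).
  by apply/seteqP; split=> _ [l tl <-]; exists l => //; rewrite xyv.
move=> tl; rewrite /variation big_nat [RHS]big_nat; apply: eq_bigr => n /= nl.
have l0 m : (m < (size l).+1)%N -> x (nth t (0 :: l) m) = y (nth t (0 :: l) m).
  by move=> ml; rewrite xy// itv_partition_nth_ge.
by rewrite (l0 n) ?ltnS 1?ltnW// -[nth t l n]/(nth t (0 :: l) n.+1) (l0 n.+1).
Qed.

Lemma eq_stieltjes_integral g x y t : (forall s, 0 <= s -> x s = y s) ->
  stieltjes_integral g x t = stieltjes_integral g y t.
Proof.
move=> xy.
have H (x' y' : R -> R) : (forall s, 0 <= s -> x' s = y' s) ->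
    neg_part_path x' = neg_part_path y'.
  move=> xy'; apply/funext => s; rewrite /neg_part_path /neg_tv xy' ?le_max ?lexx//.
  by rewrite (eq_total_variation _ xy').
have Hp : pos_part_path x = pos_part_path y.
  by apply: (H (\- x) (\- y)) => s s0 /=; rewrite xy.
by rewrite /stieltjes_integral (H _ _ xy) Hp.
Qed.

Lemma stieltjes_integral0 g t : stieltjes_integral g (fun=> 0) t = 0.
Proof.
rewrite /stieltjes_integral; suff -> : pos_part_path (fun=> 0 : R) = neg_part_path (fun=> 0) by rewrite subrr.
apply/funext => s; rewrite /pos_part_path /pos_tv; congr (fine (neg_tv _ _ _)).
by apply/funext => u /=; rewrite oppr0.
Qed.

Lemma stieltjes_integral_indic (S : set R) x t :
  measurable (S `&` `]0, t] : set (measurableTypeR R)) ->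
  stieltjes_integral \1_S x t =
  fine (stieltjes_measure (pos_part_path x) (S `&` `]0, t])) -
  fine (stieltjes_measure (neg_part_path x) (S `&` `]0, t])).
Proof.
move=> mS; rewrite /stieltjes_integral /Rintegral.
have H (mu : {measure set (measurableTypeR R) -> \bar R}) : (\int[mu]_(s in `]0%R, t]) (\1_S s)%:E = mu (S `&` `]0%R, t]))%E.
  have mI : measurable (`]0, t]%classic : set (measurableTypeR R)) by [].
  transitivity (\int[mu]_(s in `]0%R, t]) (\1_(S `&` `]0%R, t]) s)%:E)%E.
    apply: eq_integral => s; rewrite inE => st; rewrite !indicE; congr ((nat_of_bool _)%:R%:E).
    by apply/idP/idP; rewrite !inE//; case.
  by rewrite integral_indic//= -setIA setIid.
by rewrite !H.
Qed.
End path_integrals.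

Section cumulative_measures.
Context {R : realType}.
Implicit Types (f g : R -> R) (s t : R).
Local Notation cumul f := (nondecreasing f /\ right_continuous f).

Let lebesgue_stieltjes_measure_itv f (h : cumul f) a b : a <= b ->
  lebesgue_stieltjes_measure (cumulative_fun h) `]a, b]%classic = (f b - f a)%:E.
Proof.
move=> ab; rewrite /lebesgue_stieltjes_measure /measure_extension.
rewrite measurable_mu_extE/=; last exact: is_ocitv.
by rewrite wlength_itv_bnd.
Qed.

Lemma stieltjes_measure_itv f a b : cumul f -> a <= b ->
  stieltjes_measure f `]a, b]%classic = (f b - f a)%:E.
Proof.
move=> cf ab; rewrite /stieltjes_measure; case: pselect => // h.
exact: lebesgue_stieltjes_measure_itv.
Qed.

Lemma stieltjes_measureD3 f1 f2 f3 g1 g2 g3 (E : set (measurableTypeR R)) :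
  cumul f1 -> cumul f2 -> cumul f3 -> cumul g1 -> cumul g2 -> cumul g3 ->
  (forall s, f1 s + f2 s + f3 s = g1 s + g2 s + g3 s) -> measurable E ->
  (stieltjes_measure f1 E + stieltjes_measure f2 E + stieltjes_measure f3 E =
   stieltjes_measure g1 E + stieltjes_measure g2 E + stieltjes_measure g3 E)%E.
Proof.
move=> cf1 cf2 cf3 cg1 cg2 cg3 fg mE.
have n0 k : - k%:R <= k%:R :> R by rewrite lerNl (le_trans _ (ler0n R k))// oppr_le0.
apply: (@measure_sum3_unique _ (measurableTypeR R) R (@ocitv R)
  (fun k => `](- k%:R), k%:R]%classic)) => //.
- exact: ocitvI.
- by move=> k; exact: is_ocitv.
- rewrite -subTset => /= x _ /=.
  exists (Num.bound `|x|) => //=; rewrite in_itv/=.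
  have := archi_boundP (normr_ge0 x); rewrite ltr_norml => /andP[-> /ltW].
  by move=> ->.
- move=> A /ocitvP[->|[x x12 ->]]; first by rewrite !measure0.
  rewrite !stieltjes_measure_itv ?(ltW x12)// -!EFinD.
  by congr (_%:E); have := fg x.1; have := fg x.2; lra.
- by move=> k; rewrite !stieltjes_measure_itv// -!EFinD ltry.
Qed.

Lemma stieltjes_measure_itvoc_fin f t (E : set (measurableTypeR R)) : cumul f -> 0 <= t -> measurable E -> E `<=` `]0, t] ->
  stieltjes_measure f E \is a fin_num.
Proof.
move=> cf t0 mE Et; rewrite ge0_fin_numE//.
apply: le_lt_trans (_ : stieltjes_measure f `]0%R, t]%classic < +oo)%E; first by apply: le_measure; rewrite ?inE.
by rewrite stieltjes_measure_itv// ltry.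
Qed.

(** The mass of an atom is the jump of f there. *)
Lemma stieltjes_measure_set1 f s : cumul f -> f u @[u --> s^'-] --> f s ->
  stieltjes_measure f [set s] = 0.
Proof.
move=> cf fs; apply/eqP; rewrite eq_le measure_ge0 andbT.
apply/lee_addgt0Pr => e e0; rewrite add0e.
have : \forall u \near s^'-, f s - f u < e /\ u < s.
  near=> u; split; last by near: u; exact: nbhs_left_lt.
  near: u; move/cvgrPdist_lt : fs => /(_ _ e0); apply: filterS => u.
  by apply: le_lt_trans; rewrite ler_norm.
move=> H; have [u [fsu us]] := @filter_ex _ _ (at_left_proper_filter s) _ H.
apply: (@le_trans _ _ (stieltjes_measure f `]u, s]%classic)).
  by apply: le_measure; rewrite ?inE//=; move=> _ -> /=; rewrite in_itv/= us lexx.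
by rewrite stieltjes_measure_itv ?(ltW us)// lee_fin ltW.
Unshelve. all: by end_near. Qed.

Lemma countable_stieltjes_measure0 f (J : set R) : cumul f ->
  (forall s, J s -> f u @[u --> s^'-] --> f s) -> countable J ->
  (stieltjes_measure f).-negligible J.
Proof.
move=> cf fJ /countable_injP[h hinj].
rewrite (_ : J = \bigcup_n (J `&` h @^-1` [set n])); last first.
  by apply/seteqP; split => [s Js|s [n _ []]//]; exists (h s).
apply: negligible_bigcup => n.
have [->|/set0P[s [Js hs]]] := eqVneq (J `&` h @^-1` [set n]) set0.
  exact: negligible_set0.
apply: (@negligibleS _ (measurableTypeR R) _ (stieltjes_measure f) [set s]).
  by move=> u [Ju hu]; apply: hinj; rewrite ?inE// hs.
by apply/negligibleP => //; apply: stieltjes_measure_set1 => //; exact: fJ.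
Qed.
End cumulative_measures.

(** * Regular grids and step functions *)

Section grids.
Context {R : realType}.
Implicit Types (x : R -> R) (y : nat -> R) (s t : R).

Definition grid t n k : R := t * (k%:R / n.+1%:R).

(** The k-th cell carries the value [y k] and is open on the left, so that
    [y := x \o grid t n] samples x to the left of s, and the shifted sampling
    [fun k => x (grid t n k.+1)] samples it to the right. *)
Definition step t n (y : nat -> R) s : R :=
  \sum_(k < n.+1) \1_(`]grid t n k, grid t n k.+1]) s * y k.

Lemma grid0 t n : grid t n 0 = 0.
Proof. by rewrite /grid mul0r mulr0. Qed.

Lemma gridn t n : grid t n n.+1 = t.
Proof. by rewrite /grid divff ?mulr1// pnatr_eq0. Qed.

Lemma gridS t n k : grid t n k.+1 = grid t n k + t / n.+1%:R.
Proof. by rewrite /grid -natr1 mulrDl mul1r mulrDr. Qed.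

Lemma le_grid t n : 0 <= t -> {homo grid t n : k l / (k <= l)%N >-> k <= l}.
Proof.
by move=> t0 k l kl; rewrite /grid ler_wpM2l// ler_pM2r ?invr_gt0 ?ltr0n// ler_nat.
Qed.

Lemma grid_ge0 t n k : 0 <= t -> 0 <= grid t n k.
Proof. by move=> t0; rewrite -(grid0 t n) le_grid. Qed.

Lemma gridP t n s : 0 < s -> s <= t ->
  exists2 k, (k < n.+1)%N & grid t n k < s <= grid t n k.+1.
Proof.
move=> s0 st.
have ex : exists k, s <= grid t n k by exists n.+1; rewrite gridn.
pose k := ex_minn ex; have : s <= grid t n k by rewrite /k; case: ex_minnP.
have kmin m : (m < k)%N -> grid t n m < s.
  rewrite /k; case: ex_minnP => k' _ min mk; rewrite ltNge; apply/negP => /min.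
  by rewrite leqNgt mk.
have kn : (k <= n.+1)%N by rewrite /k; case: ex_minnP => k' _; apply; rewrite gridn.
case: k kmin kn => [|k] kmin kn sk; first by move: sk; rewrite grid0 leNgt s0.
by exists k => //; rewrite sk andbT kmin.
Qed.

Lemma stepE t n y k s : 0 <= t -> (k < n.+1)%N ->
  grid t n k < s <= grid t n k.+1 -> step t n y s = y k.
Proof.
move=> t0 kn /andP[ks sk]; rewrite /step (bigD1 (Ordinal kn))//=.
rewrite big1 ?addr0 => [|j jk].
  by rewrite indicE mem_set ?mul1r//= in_itv/= ks sk.
rewrite indicE memNset ?mul0r//= in_itv/=; apply/negP; rewrite negb_and -leNgt -ltNge.
have [jk'|kj|jk'] := ltngtP j k.
- by apply/orP; right; apply: le_lt_trans ks; exact: le_grid.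
- by rewrite (le_trans sk)// le_grid.
- by move: jk; rewrite -val_eqE/= jk' eqxx.
Qed.

Lemma cvg_grid_mesh t : t / n.+1%:R @[n --> \oo] --> 0.
Proof.
rewrite -(mulr0 t); apply: cvgMr; exact: cvg_harmonic.
Qed.

Lemma cvg_step_left t x (l s : R) : 0 < s -> s <= t -> x u @[u --> s^'-] --> l ->
  step t n (fun k => x (grid t n k)) s @[n --> \oo] --> l.
Proof.
move=> s0 st xl; apply/cvgrPdist_lt => e e0.
have t0 : 0 < t := lt_le_trans s0 st.
move/cvgrPdist_lt : xl => /(_ _ e0)[d /= d0 xd].
move/cvgrPdist_lt : (cvg_grid_mesh t) => /(_ _ d0); apply: filterS => n.
rewrite sub0r normrN ger0_norm ?divr_ge0 ?(ltW t0)// => nd.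
have [k kn ksk] := gridP n s0 st; rewrite (stepE _ (ltW t0) kn ksk).
move: ksk; rewrite gridS => /andP[ks sk]; apply: xd => //=.
by rewrite ger0_norm ?subr_ge0 ?(ltW ks)// ltrBlDl (le_lt_trans sk)// ltrD2l.
Qed.

Lemma cvg_step_right t x s : 0 < s -> s <= t -> x u @[u --> s^'+] --> x s ->
  step t n (fun k => x (grid t n k.+1)) s @[n --> \oo] --> x s.
Proof.
move=> s0 st xl; apply/cvgrPdist_lt => e e0.
have t0 : 0 < t := lt_le_trans s0 st.
move/cvgrPdist_lt : xl => /(_ _ e0)[d /= d0 xd].
move/cvgrPdist_lt : (cvg_grid_mesh t) => /(_ _ d0); apply: filterS => n.
rewrite sub0r normrN ger0_norm ?divr_ge0 ?(ltW t0)// => nd.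
have [k kn ksk] := gridP n s0 st; rewrite (stepE _ (ltW t0) kn ksk).
move: ksk => /andP[ks]; rewrite le_eqVlt => /predU1P[<-|sk].
  by rewrite subrr normr0.
apply: xd => //=; rewrite distrC ger0_norm ?subr_ge0 ?(ltW sk)// ltrBlDl.
by rewrite gridS ltr_leD// ltW.
Qed.

Lemma measurable_step t n y : measurable_fun setT (step t n y).
Proof.
apply: measurable_sum => k; apply: measurable_funM => //.
Qed.

End grids.

(** * Jumps of a cadlag path *)

Section cadlag_paths.
Context {R : realType}.
Implicit Types (x y : R -> R) (s t : R).

(** An upward jump at s passes over a rational r, and x stays below r on some
    interval ]q, s[ with q rational; two times with the same q and r would
    contradict each other.  Downward jumps are the upward jumps of -x, whence the
    sign [(-1) ^+ b]. *)
Lemma countable_jumps x : cadlag_path x ->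
  countable [set s | 0 < s /\ left_limit x s != x s].
Proof.
move=> [xr xl].
pose J (b : bool) (q r : rat) := [set s | [/\ 0 < s, ratr q < s,
  forall u, ratr q < u -> u < s -> (-1) ^+ b * x u < ratr r & ratr r < (-1) ^+ b * x s]].
apply: (@sub_countable _ _ _ (\bigcup_b (\bigcup_q (\bigcup_r J b q r)))); last first.
  apply: bigcup_countable => // b _; apply: bigcup_countable => // q _.
  apply: bigcup_countable => // r _.
  have Jlt s1 s2 : J b q r s1 -> J b q r s2 -> ~ s1 < s2.
    move=> [_ qs1 _ rs1] [_ _ /(_ _ qs1) H _] /H /(lt_trans rs1).
    by rewrite ltxx.
  have [->|/set0P[s Js]] := eqVneq (J b q r) set0; first exact: countable0.
  apply: (sub_countable _ (countable1 s)); apply: subset_card_le => u Ju /=.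
  by have [us|us|//] := ltgtP u s; [have := Jlt _ _ Ju Js|have := Jlt _ _ Js Ju].
apply: subset_card_le => s [s0]; rewrite neq_lt.
have xsl : x u @[u --> s^'-] --> left_limit x s by rewrite /left_limit s0; exact: xl.
have key (b : bool) : (-1) ^+ b * left_limit x s < (-1) ^+ b * x s ->
    (\bigcup_q (\bigcup_r J b q r)) s.
  move=> /rat_in_itvoo[r]; rewrite in_itv/= => /andP[lr rx].
  have : \forall u \near s^'-, (-1) ^+ b * x u < ratr r.
    have /cvgr_lt : (-1) ^+ b * x u @[u --> s^'-] --> (-1) ^+ b * left_limit x s.
      exact: cvgMr.
    exact.
  move=> [/= d d0 dr]; have sd : s - d < s by rewrite ltrBlDr ltrDl.
  have [q] := rat_in_itvoo sd; rewrite in_itv/= => /andP[sq qs].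
  exists q => //; exists r => //; split => // u qu us; apply: dr => //=.
  by rewrite ger0_norm ?subr_ge0 ?ltW// ltrBlDr addrC -ltrBlDr (lt_trans sq).
case/orP => h; [exists false|exists true] => //; apply: key.
  by rewrite expr0 !mul1r.
by rewrite expr1 !mulN1r ltrN2.
Qed.

Lemma measurable_left_limit x t : cadlag_path x ->
  measurable_fun (`]0, t]%classic : set R) (left_limit x).
Proof.
move=> [_ xl]; apply: (@measurable_fun_cvg _ _ _ _
  (fun n => step t n (fun k => x (grid t n k)))) => [n|s /=].
  by apply: measurable_funTS; exact: measurable_step.
rewrite in_itv/= => /andP[s0 st]; apply: cvg_step_left => //.
by rewrite /left_limit s0; exact: xl.
Qed.

Lemma measurable_right_continuous_path x t :
  (forall s, 0 <= s -> x u @[u --> s^'+] --> x s) ->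
  measurable_fun (`]0, t]%classic : set R) x.
Proof.
move=> xr; apply: (@measurable_fun_cvg _ _ _ _
  (fun n => step t n (fun k => x (grid t n k.+1)))) => [n|s /=].
  by apply: measurable_funTS; exact: measurable_step.
rewrite in_itv/= => /andP[s0 st]; apply: cvg_step_right => //.
by apply: xr; exact: ltW.
Qed.

Lemma neg_part_pathE x s : finite_variation_path x -> 0 <= s ->
  neg_part_path x s = (fine (total_variation 0 s x) - x s) / 2.
Proof.
move=> xfv s0; rewrite /neg_part_path max_r//.
have /(bounded_variationP _ s0)/fineK := xfv s s0.
by move=> h; rewrite /neg_tv -{1}h -EFinB -EFinM.
Qed.

Lemma pos_part_pathE x s : finite_variation_path x -> 0 <= s ->
  pos_part_path x s = (fine (total_variation 0 s x) + x s) / 2.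
Proof.
move=> xfv s0; rewrite [LHS](@neg_part_pathE (\- x))//; last first.
  by move=> u u0; exact: bounded_variationN (xfv u u0).
by rewrite total_variationN/= opprK.
Qed.

(** The Jordan parts are constant at negative times, so identities between them
    need checking at nonnegative times only. *)
Lemma jordan_parts_max x s : (pos_part_path x (Num.max 0 s) = pos_part_path x s) *
  (neg_part_path x (Num.max 0 s) = neg_part_path x s).
Proof. by rewrite /pos_part_path /neg_part_path maxA maxxx. Qed.

Lemma neg_part_path_left x s : finite_variation_path x -> 0 < s ->
  x u @[u --> s^'-] --> x s ->
  neg_part_path x u @[u --> s^'-] --> neg_part_path x s.
Proof.
move=> xfv s0 xs; rewrite neg_part_pathE ?(ltW s0)//.
apply: (@cvg_trans _ ((fine (total_variation 0 u x) - x u) / 2 @[u --> s^'-])).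
  apply: near_eq_cvg; near=> u; rewrite neg_part_pathE//.
  by apply: ltW; near: u; exact: nbhs_left_gt.
apply: cvgMl; apply: cvgB => //.
exact: total_variation_left_continuous (lexx s) xs (xfv s (ltW s0)).
Unshelve. all: by end_near. Qed.

Lemma pos_part_path_left x s : finite_variation_path x -> 0 < s ->
  x u @[u --> s^'-] --> x s ->
  pos_part_path x u @[u --> s^'-] --> pos_part_path x s.
Proof.
move=> xfv s0 xs; apply: (@neg_part_path_left (\- x)) => //; last exact: cvgN.
by move=> u u0; exact: bounded_variationN (xfv u u0).
Qed.

Let fine_balance (p1 p2 p3 n1 n2 n3 : \bar R) :
  (p1 + p2 + p3 = n1 + n2 + n3)%E -> p1 \is a fin_num -> p2 \is a fin_num ->
  p3 \is a fin_num -> n1 \is a fin_num -> n2 \is a fin_num -> n3 \is a fin_num ->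
  fine p1 - fine n1 = fine n2 - fine p2 + (fine n3 - fine p3).
Proof.
by move: p1 p2 p3 n1 n2 n3 => [?| |] [?| |] [?| |] [?| |] [?| |] [?| |] //= [] H; lra.
Qed.

(** With a = p_a - n_a and so on, the identity p_a + n_c + n_v = n_a + p_c + p_v
    holds pointwise, although p_a and p_c + p_v differ in general; it passes to
    the measures, which are finite on ]0, t]. *)
Lemma stieltjes_integral_indicD (S : set R) (a c v : R -> R) t :
  (forall s, 0 <= s -> a u @[u --> s^'+] --> a s) -> finite_variation_path a ->
  (forall s, 0 <= s -> c u @[u --> s^'+] --> c s) -> finite_variation_path c ->
  (forall s, 0 <= s -> v u @[u --> s^'+] --> v s) -> finite_variation_path v ->
  (forall s, 0 <= s -> a s = c s + v s) -> 0 <= t ->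
  measurable (S `&` `]0, t] : set (measurableTypeR R)) ->
  stieltjes_integral \1_S a t = stieltjes_integral \1_S c t + stieltjes_integral \1_S v t.
Proof.
move=> ar afv cr cfv vr vfv acv t0 mS; rewrite !stieltjes_integral_indic//.
have pa := pos_part_path_cumulative ar afv; have na := neg_part_path_cumulative ar afv.
have pc := pos_part_path_cumulative cr cfv; have nc := neg_part_path_cumulative cr cfv.
have pv := pos_part_path_cumulative vr vfv; have nv := neg_part_path_cumulative vr vfv.
have E0 : S `&` `]0, t] `<=` `]0, t] by move=> ? [].
have parts u : pos_part_path a u + neg_part_path c u + neg_part_path v u =
    neg_part_path a u + pos_part_path c u + pos_part_path v u.
  have u0 : 0 <= Num.max 0 u by rewrite le_max lexx.
  rewrite -!(jordan_parts_max _ u) !neg_part_pathE// !pos_part_pathE// acv//.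
  by field.
apply: fine_balance; first by apply: stieltjes_measureD3.
all: exact: (stieltjes_measure_itvoc_fin _ t0).
Qed.

Lemma continuous_path_right c s : continuous_path c -> 0 <= s ->
  c u @[u --> s^'+] --> c s.
Proof.
move=> /continuous_within_itvcyP[cc c0]; rewrite le_eqVlt => /predU1P[<-//|s0].
have s0y : s \in `]0, +oo[ by rewrite in_itv/= s0.
by have /left_right_continuousP[] := cc s s0y.
Qed.

Lemma continuous_path_left c s : continuous_path c -> 0 < s ->
  c u @[u --> s^'-] --> c s.
Proof.
move=> /continuous_within_itvcyP[cc _] s0.
have s0y : s \in `]0, +oo[ by rewrite in_itv/= s0.
by have /left_right_continuousP[] := cc s s0y.
Qed.

(** The two integrands differ at jump times of x only, and these form a countable
    set, which is null for dc since c is continuous. *)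
Lemma stieltjes_integral_left_limit x c t : cadlag_path x ->
  continuous_path c -> finite_variation_path c ->
  stieltjes_integral \1_[set s | left_limit x s != 0] c t =
  stieltjes_integral \1_[set s | x s != 0] c t.
Proof.
move=> xcadlag cc cfv.
have cr s : 0 <= s -> c u @[u --> s^'+] --> c s by exact: continuous_path_right.
have cl s : 0 < s -> c u @[u --> s^'-] --> c s by exact: continuous_path_left.
pose I := (`]0, t]%classic : set (measurableTypeR R)).
have mI : measurable I by rewrite /I.
have ml : measurable_fun I (left_limit x) by exact: measurable_left_limit.
have mx : measurable_fun I x by exact: measurable_right_continuous_path xcadlag.1.
have mne (y : R -> R) : measurable_fun I y -> measurable ([set s | y s != 0] `&` I).
  move=> my; rewrite setIC (_ : [set s | y s != 0] = y @^-1` (~` [set 0])).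
    by apply: my => //; exact: measurableC.
  by apply/seteqP; split => s /= /eqP.
pose J := [set s | left_limit x s - x s != 0] `&` I.
have mJ : measurable J by apply: (mne (left_limit x \- x)); exact: measurable_funB.
have H f : nondecreasing f /\ right_continuous f ->
    (forall s, 0 < s -> f u @[u --> s^'-] --> f s) ->
    stieltjes_measure f ([set s | left_limit x s != 0] `&` I) =
    stieltjes_measure f ([set s | x s != 0] `&` I).
  move=> cf fl; have J0 : stieltjes_measure f J = 0%E.
    apply: measure_negligible => //.
    apply: (@negligibleS _ (measurableTypeR R) _ (stieltjes_measure f)
      [set s | 0 < s /\ left_limit x s != x s]).
      by move=> s [] /=; rewrite subr_eq0 /I /= in_itv/= => ? /andP[].
    apply: countable_stieltjes_measure0 => // [s []//|]; first by move=> s0 _; exact: fl.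
    exact: countable_jumps.
  have le (A B : set (measurableTypeR R)) : measurable A -> measurable B -> A `<=` B `|` J ->
      (stieltjes_measure f A <= stieltjes_measure f B)%E.
    move=> mA mB AB; rewrite -[leRHS]adde0 -J0.
    apply: le_trans (measureU2 _ _ _) => //.
    by apply: le_measure; rewrite ?inE//; exact: measurableU.
  apply/eqP; rewrite eq_le; apply/andP; split; apply: le; try exact: mne.
  - move=> s [/= ls Is]; have [xs|xs] := eqVneq (x s) 0.
      by right; split => //=; rewrite xs subr0.
    by left.
  - move=> s [/= xs Is]; have [ls|ls] := eqVneq (left_limit x s) 0.
      by right; split => //=; rewrite ls sub0r oppr_eq0.
    by left.
rewrite !stieltjes_integral_indic; [|exact: mne..].
rewrite !H//.
- exact: neg_part_path_cumulative.
- by move=> s s0; apply: neg_part_path_left => //; exact: cl.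
- exact: pos_part_path_cumulative.
- by move=> s s0; apply: pos_part_path_left => //; exact: cl.
Qed.

Lemma left_limit_ne0_measurable x t : cadlag_path x ->
  measurable ([set s | left_limit x s != 0] `&` `]0, t] : set (measurableTypeR R)).
Proof.
move=> xc.
rewrite setIC (_ : [set s | left_limit x s != 0] = left_limit x @^-1` (~` [set 0])).
  have ml : measurable_fun (`]0, t]%classic : set (measurableTypeR R)) (left_limit x).
    exact: measurable_left_limit.
  by apply: ml => //; exact: measurableC.
by apply/seteqP; split => s /= /eqP.
Qed.

End cadlag_paths.

(** * Filtrations and stopped clocks *)

Section filtrations.
Context {d : measure_display} {T : measurableType d} {R : realType}.
Variables (P : probability T R) (F : R -> set (set T)) (hF : usual_conditions P F).
Implicit Types (rho sigma : T -> \bar R) (t : R).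

(** T with the sigma-algebra F_t, so that the lemmas on measurable functions
    apply to F_t-measurability. *)
Definition filtration_space t := g_sigma_algebraType (F t).

Lemma filtration_spaceP t (A : set T) : 0 <= t -> measurable (A : set (filtration_space t)) <-> F t A.
Proof.
move=> t0; rewrite /filtration_space measurable_g_measurableTypeE//.
exact: filtration_sigma_algebra hF _ t0.
Qed.

Lemma measurable_wrtP t (Y : T -> R) : 0 <= t ->
  measurable_wrt (F t) Y <-> measurable_fun (setT : set (filtration_space t)) Y.
Proof.
move=> t0; split=> [mY _ B mB|mY B mB].
  by apply/(filtration_spaceP _ t0); rewrite setTI; exact: mY.
by apply/(filtration_spaceP _ t0); rewrite -[X in measurable X]setTI; exact: mY.
Qed.

Lemma measurable_wrt_measurable t (Y : T -> R) : 0 <= t ->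
  measurable_wrt (F t) Y -> measurable_fun setT Y.
Proof.
move=> t0 mY _ B mB; rewrite setTI.
by apply: (filtration_measurable hF t0); exact: mY.
Qed.

Lemma filtration_negligible t N : 0 <= t -> P.-negligible N -> F t N.
Proof.
move=> t0 /(filtration_complete hF); exact: (filtration_nondecreasing hF).
Qed.

Lemma probability_complete : measure_is_complete P.
Proof.
by move=> N /(filtration_negligible (lexx 0)); exact: (filtration_measurable hF).
Qed.

Lemma filtrationI t A B : 0 <= t -> F t A -> F t B -> F t (A `&` B).
Proof.
by move=> t0 /(filtration_spaceP _ t0) FA /(filtration_spaceP _ t0) FB; apply/(filtration_spaceP _ t0); exact: measurableI.
Qed.

Lemma filtrationU t A B : 0 <= t -> F t A -> F t B -> F t (A `|` B).
Proof.
by move=> t0 /(filtration_spaceP _ t0) FA /(filtration_spaceP _ t0) FB; apply/(filtration_spaceP _ t0); exact: measurableU.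
Qed.

Lemma filtrationD t A B : 0 <= t -> F t A -> F t B -> F t (A `\` B).
Proof.
by move=> t0 /(filtration_spaceP _ t0) FA /(filtration_spaceP _ t0) FB; apply/(filtration_spaceP _ t0); exact: measurableD.
Qed.

Lemma filtrationC t A : 0 <= t -> F t A -> F t (~` A).
Proof.
by move=> t0 /(filtration_spaceP _ t0) FA; apply/(filtration_spaceP _ t0); exact: measurableC.
Qed.

Lemma filtrationT t : 0 <= t -> F t setT.
Proof. by move=> t0; apply/(filtration_spaceP _ t0). Qed.

Lemma ae_measurable (f g : T -> R) :
  (\forall w \ae P, f w = g w) -> measurable_fun setT f -> measurable_fun setT g.
Proof.
move=> fg mf; apply/measurable_EFinP; apply: (ae_measurable_fun probability_complete) (_ : measurable_fun setT (EFin \o f)).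
  by apply: filterS fg => w fgw _ /=; rewrite fgw.
exact/measurable_EFinP.
Qed.

(** [clock rho t] is the time min(t, rho) at which [stopped X rho t] reads X. *)
Definition clock rho t w : R := fine (Order.min t%:E (rho w)).

Lemma stoppedE (X : R -> T -> R) rho t w : stopped X rho t w = X (clock rho t w) w.
Proof. by []. Qed.

Lemma clockE rho t w : (0 <= rho w)%E -> ((clock rho t w)%:E = Order.min t%:E (rho w))%E.
Proof.
rewrite /clock; case: (rho w) => [r| |]//= _; last by rewrite min_l ?leey.
by rewrite -EFin_min.
Qed.

Lemma clock_leE rho t w r : (0 <= rho w)%E ->
  (clock rho t w <= r) = (t <= r) || (rho w <= r%:E)%E.
Proof. by move=> rho0; rewrite -lee_fin clockE// ge_min lee_fin. Qed.

Lemma clock_ge0 rho t w : 0 <= t -> (0 <= rho w)%E -> 0 <= clock rho t w.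
Proof. by move=> t0 rho0; rewrite -lee_fin clockE// le_min lee_fin t0. Qed.

Lemma clock_le rho t w : (0 <= rho w)%E -> clock rho t w <= t.
Proof. by move=> rho0; rewrite clock_leE// lexx. Qed.

Lemma le_clock rho s t w : (0 <= rho w)%E -> s <= t -> clock rho s w <= clock rho t w.
Proof.
by move=> rho0 st; rewrite -lee_fin !clockE// le_min2// lee_fin.
Qed.

Lemma clock_le_filtration rho t r : stopping_time F rho -> 0 <= t -> 0 <= r ->
  F r [set w | clock rho t w <= r].
Proof.
move=> [rho0 rhoF] t0 r0; have [tr|rt] := leP t r.
  rewrite (_ : [set _ | _] = setT); first exact: filtrationT.
  by apply/seteqP; split=> w //= _; rewrite clock_leE// tr.
rewrite (_ : [set _ | _] = [set w | rho w <= r%:E]%E); first exact: rhoF.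
by apply/seteqP; split=> w /=; rewrite clock_leE// [t <= r]leNgt rt.
Qed.

End filtrations.

(** * Optional stopping *)

Section truncation.
Context {R : realType}.
Implicit Types (K y : R).

(** This is y truncated to [-K, K], in a form free of case distinctions; hence
    [excess] is max(|y| - K, 0). *)
Definition clamp K y := (`|y + K| - `|y - K|) / 2.
Definition excess K y := `|y - clamp K y|.

Lemma excess_gt K y : 0 <= K -> K < y -> excess K y = y - K.
Proof.
move=> K0 Ky; rewrite /excess /clamp [`|y + K|]ger0_norm ?[`|y - K|]ger0_norm; try lra.
by rewrite ger0_norm; lra.
Qed.

Lemma excess_lt K y : 0 <= K -> y < - K -> excess K y = - y - K.
Proof.
move=> K0 Ky; rewrite /excess /clamp [`|y + K|]ler0_norm ?[`|y - K|]ler0_norm; try lra.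
by rewrite ler0_norm; lra.
Qed.

Lemma excess_eq0 K y : - K <= y <= K -> excess K y = 0.
Proof.
move=> Ky; rewrite /excess /clamp [`|y + K|]ger0_norm ?[`|y - K|]ler0_norm; try lra.
by apply/eqP; rewrite normr_eq0; apply/eqP; lra.
Qed.

Lemma excess_cases K y : 0 <= K ->
  [\/ K < y, y < - K | - K <= y <= K].
Proof.
move=> K0; have [|h1] := ltP K y; first by constructor 1.
have [|h2] := ltP y (- K); first by constructor 2.
by constructor 3; lra.
Qed.

Lemma excess_ge K y : 0 <= K -> y - K <= excess K y /\ - y - K <= excess K y.
Proof.
move=> K0; have [h|h|h] := excess_cases y K0.
- by rewrite excess_gt//; lra.
- by rewrite excess_lt//; lra.
- by rewrite excess_eq0//; lra.
Qed.

Lemma excess_le K y : 0 <= K -> excess K y <= `|y|.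
Proof.
move=> K0; have [h|h|h] := excess_cases y K0.
- by rewrite excess_gt// ger0_norm; lra.
- by rewrite excess_lt// ler0_norm; lra.
- by rewrite excess_eq0.
Qed.

Lemma excess0 y : excess 0 y = `|y|.
Proof. by rewrite /excess /clamp addr0 subr0 subrr mul0r subr0. Qed.

Lemma clamp_le K y : 0 <= K -> `|clamp K y| <= K.
Proof.
move=> K0; rewrite /clamp normrM [`|2^-1|]ger0_norm// ler_pdivrMr//.
apply: le_trans (ler_dist_dist _ _) _.
by rewrite (_ : y + K - (y - K) = K * 2) ?ger0_norm//; [rewrite mulr_ge0|ring].
Qed.

Lemma cvg_clamp K (u : R^nat) l : u n @[n --> \oo] --> l ->
  clamp K (u n) @[n --> \oo] --> clamp K l.
Proof.
move=> ul; apply: cvgMl; apply: cvgB; apply: cvg_norm.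
- by apply: cvgD => //; exact: cvg_cst.
- by apply: cvgB => //; exact: cvg_cst.
Qed.

Lemma cvg_excess K (u : R^nat) l : u n @[n --> \oo] --> l ->
  excess K (u n) @[n --> \oo] --> excess K l.
Proof. by move=> ul; apply: cvg_norm; apply: cvgB => //; exact: cvg_clamp. Qed.

Lemma measurable_clamp K : measurable_fun setT (clamp K).
Proof.
apply: measurable_funM => //; apply: measurable_funB; apply: measurableT_comp => //.
  exact: measurable_funD.
exact: measurable_funB.
Qed.

Lemma measurable_excess K : measurable_fun setT (excess K).
Proof.
apply: measurableT_comp => //; apply: measurable_funB => //; exact: measurable_clamp.
Qed.

End truncation.

Section optional_stopping.
Context {d : measure_display} {T : measurableType d} {R : realType}.
Variables (P : probability T R) (F : R -> set (set T)) (hF : usual_conditions P F).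
Implicit Types (rho : T -> \bar R) (t : R).

Section grid_stopping.
Variables (rho : T -> \bar R) (t : R) (st_rho : stopping_time F rho) (t0 : 0 <= t).

Let A n i := [set w | clock rho t w <= grid t n i].

(** [cell n i] is the event that min(t, rho) is rounded up to the i-th grid point. *)
Definition cell n := seqD (A n).

Let ndA n : nondecreasing_seq (A n).
Proof.
move=> i j ij; apply/subsetPset => w /= /le_trans; apply; exact: le_grid.
Qed.

Lemma cell_filtration n i : F (grid t n i) (cell n i).
Proof.
have g0 := grid_ge0 n i t0.
case: i g0 => [|i] g0; first exact: (clock_le_filtration hF).
apply: (filtrationD hF) => //; first exact: (clock_le_filtration hF).
have gi := grid_ge0 n i t0.
apply: (filtration_nondecreasing hF gi) => //; first exact: le_grid.
exact: (clock_le_filtration hF).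
Qed.

Lemma measurable_cell n i : measurable (cell n i).
Proof. by apply: (filtration_measurable hF) (cell_filtration n i); exact: grid_ge0. Qed.

Lemma trivIset_cell n : trivIset setT (cell n).
Proof. by apply: trivIset_seqD; exact: ndA. Qed.

Lemma bigsetU_cell n : \big[setU/set0]_(i < n.+2) cell n i = setT.
Proof.
rewrite nondecreasing_bigsetU_seqD; last exact: ndA.
by apply/seteqP; split => // w _; rewrite /A /= gridn clock_le//; case: st_rho.
Qed.

Lemma cellP n w : exists2 i, (i < n.+2)%N & cell n i w.
Proof.
have : (\big[setU/set0]_(i < n.+2) cell n i) w by rewrite bigsetU_cell.
by rewrite -bigcup_mkord => -[i /= ? ?]; exists i.
Qed.

Definition grid_stopped (L : R -> T -> R) n w : R :=
  \sum_(i < n.+2) \1_(cell n i) w * L (grid t n i) w.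

Lemma grid_stoppedE L n i w : (i < n.+2)%N -> cell n i w ->
  grid_stopped L n w = L (grid t n i) w.
Proof.
move=> ni iw; rewrite /grid_stopped (bigD1 (Ordinal ni))//= indicE mem_set// mul1r.
rewrite big1 ?addr0// => j ji; rewrite indicE memNset ?mul0r// => jw.
move/eqP : ji; apply; apply/val_inj => /=.
by apply: (@trivIset_cell n j i I I); exists w.
Qed.

Lemma cell_bounds n i w : cell n i w ->
  clock rho t w <= grid t n i <= clock rho t w + t / n.+1%:R.
Proof.
have rho0 : (0 <= rho w)%E by case: st_rho.
case: i => [|i] => [/=|[/= -> /negP]].
  rewrite /cell /seqD /A /= grid0 => ->/=.
  by rewrite addr_ge0 ?clock_ge0// divr_ge0.
by rewrite -ltNge => /ltW iw; rewrite gridS lerD2r.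
Qed.

(** The rounded time tends to the stopping time from the right. *)
Lemma cvg_grid_stopped (L : R -> T -> R) w :
  L u w @[u --> (clock rho t w)^'+] --> L (clock rho t w) w ->
  grid_stopped L n w @[n --> \oo] --> stopped L rho t w.
Proof.
rewrite stoppedE; set c := clock rho t w => Lc; apply/cvgrPdist_lt => e e0.
move/cvgrPdist_lt : Lc => /(_ _ e0)[r /= r0 Lr].
move/cvgrPdist_lt : (cvg_grid_mesh t) => /(_ _ r0); apply: filterS => n.
rewrite sub0r normrN ger0_norm ?divr_ge0// => nr.
have [i ni iw] := cellP n w; rewrite (grid_stoppedE L ni iw).
have /andP[] := cell_bounds iw; rewrite -/c le_eqVlt => /predU1P[<- _|ci ic].
  by rewrite subrr normr0.
apply: Lr => //=; rewrite distrC ger0_norm ?subr_ge0 ?(ltW ci)// ltrBlDl.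
by rewrite (le_lt_trans ic)// ltrD2l.
Qed.

Lemma measurable_grid_stopped (L : R -> T -> R) n :
  (forall s, 0 <= s -> measurable_fun setT (L s)) ->
  measurable_fun setT (grid_stopped L n).
Proof.
move=> mL; apply: measurable_sum => i; apply: measurable_funM.
  by apply: measurable_indic; exact: measurable_cell.
by apply: mL; exact: grid_ge0.
Qed.

(** The stopped variable is the almost sure limit of the grid-stopped ones, and the
    probability space is complete; the upper limit is a measurable function that
    coincides with the limit where the latter exists. *)
Lemma measurable_stopped (L : R -> T -> R) :
  (forall s, 0 <= s -> measurable_fun setT (L s)) ->
  (\forall w \ae P, forall s, 0 <= s -> L u w @[u --> s^'+] --> L s w) ->
  measurable_fun setT (stopped L rho t).
Proof.
move=> mL Lrc.
pose l w := limn_esup (fun n => (grid_stopped L n w)%:E).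
have ml : measurable_fun setT (fine \o l).
  apply: measurableT_comp => //; apply: measurable_fun_limn_esup => n.
  by apply/measurable_EFinP; exact: measurable_grid_stopped.
apply: (ae_measurable hF) ml; apply: filterS Lrc => w Lw.
have cw : (grid_stopped L n w)%:E @[n --> \oo] --> (stopped L rho t w)%:E.
  apply: cvg_EFin; first exact: nearW.
  by apply: cvg_grid_stopped; apply: Lw; rewrite clock_ge0//; case: st_rho.
by rewrite /= /l is_cvg_limn_esupE; [rewrite (cvg_lim _ cw)|apply/cvg_ex; eexists; exact: cw].
Qed.

Lemma integral_cells n (f : T -> R) : measurable_fun setT f ->
  (\int[P]_w (f w)%:E = \sum_(i < n.+2) \int[P]_(w in cell n i) (f w)%:E)%E.
Proof.
move=> mf; rewrite -{1}(bigsetU_cell n).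
rewrite -!(big_mkord xpredT) integral_bigsetU_EFin//.
- by rewrite big_mkord.
- exact: measurable_cell.
- exact: iota_uniq.
- by apply: sub_trivIset (@trivIset_cell n).
- by apply/measurable_EFinP; exact: measurable_funTS.
Qed.

End grid_stopping.

Section martingale_stopping.
Variables (L : R -> T -> R) (mL : martingale P F L) (t : R) (t0 : 0 <= t).
Hypothesis Lrc : \forall w \ae P, forall s, 0 <= s -> L u w @[u --> s^'+] --> L s w.

Let measL s : 0 <= s -> measurable_fun setT (L s).
Proof. by move=> s0; apply: (measurable_wrt_measurable hF s0); case: mL => /(_ _ s0). Qed.

Let intL s : 0 <= s -> P.-integrable setT (EFin \o L s).
Proof. by case: mL => _ + _; apply. Qed.

Let mart s G : 0 <= s -> s <= t -> F s G ->
  (\int[P]_(w in G) (L s w)%:E = \int[P]_(w in G) (L t w)%:E)%E.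
Proof. by move=> s0 st FG; case: mL => _ _ /(_ _ _ s0 st)[_ _ ->]. Qed.

(** On an event where the convex function [excess K] coincides with one of its
    affine minorants, its mean can only grow, since the mean of the affine function
    is conserved. *)
Lemma excess_submartingale_part (e : R) s K H : 0 <= s -> s <= t -> F s H -> 0 <= K ->
  (forall y, e * y - K <= excess K y) ->
  (forall w, H w -> excess K (L s w) = e * L s w - K) ->
  (\int[P]_(w in H) (excess K (L s w))%:E <= \int[P]_(w in H) (excess K (L t w))%:E)%E.
Proof.
move=> s0 st FH K0 eK HK.
have mH : measurable H := filtration_measurable hF s0 FH.
have intH u : 0 <= u -> P.-integrable H (fun w => (L u w)%:E).
  by move=> u0; apply: integrableS (intL u0).
have intK : P.-integrable H (fun=> K%:E).
  by apply: (@integrableS _ _ _ _ setT) => //; exact: finite_measure_integrable_cst.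
have intB u : 0 <= u -> (\int[P]_(w in H) (e * L u w - K)%:E =
    e%:E * \int[P]_(w in H) (L u w)%:E - \int[P]_(w in H) K%:E)%E.
  move=> u0; under eq_integral do rewrite EFinB EFinM.
  by rewrite integralB//= ?integralZl//; [exact: intH|apply: integrableZl => //; exact: intH].
rewrite (_ : (\int[P]_(w in H) (excess K (L s w))%:E)%E =
  (\int[P]_(w in H) (e * L s w - K)%:E)%E); last first.
  by apply: eq_integral => w /set_mem Hw; rewrite HK.
rewrite intB// mart// -intB//; apply: le_integral => //.
- under [X in P.-integrable _ X]funext do rewrite EFinB EFinM.
  by apply: integrableB => //; apply: integrableZl => //; exact: intH.
- apply: (@le_integrable _ _ _ _ _ mH _ (EFin \o L t)); last exact: intH.
    apply/measurable_EFinP/measurable_funTS; apply: measurableT_comp; first exact: measurable_excess.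
    exact: measL.
  by move=> w Hw /=; rewrite lee_fin ger0_norm ?excess_le//; exact: normr_ge0.
- by move=> w _; rewrite lee_fin eK.
Qed.

(** The three pieces of [excess K] are -y - K, 0 and y - K. *)
Lemma excess_submartingale s K G : 0 <= s -> s <= t -> F s G -> 0 <= K ->
  (\int[P]_(w in G) (excess K (L s w))%:E <= \int[P]_(w in G) (excess K (L t w))%:E)%E.
Proof.
move=> s0 st FG K0.
pose B1 := [set w | K < L s w]; pose B2 := [set w | L s w < - K].
have adL : measurable_wrt (F s) (L s) by case: mL => /(_ _ s0).
have FB1 : F s B1.
  by rewrite (_ : B1 = L s @^-1` `]K, +oo[%classic); [exact: adL|apply/seteqP; split=> w /=; rewrite in_itv/= andbT].
have FB2 : F s B2.
  by rewrite (_ : B2 = L s @^-1` `]-oo, - K[%classic); [exact: adL|apply/seteqP; split=> w /=; rewrite in_itv/=].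
have FG1 : F s (G `&` B1) by exact: (filtrationI hF).
have FG2 : F s (G `&` B2) by exact: (filtrationI hF).
have FG3 : F s (G `\` (B1 `|` B2)) by apply: (filtrationD hF) => //; exact: (filtrationU hF).
have mF H : F s H -> measurable H by exact: (filtration_measurable hF s0).
have GE : G = (G `&` B1) `|` ((G `&` B2) `|` (G `\` (B1 `|` B2))).
  apply/seteqP; split => [w Gw|w [[]|[[]|[]]]//].
  have [?|B1w] := pselect (B1 w); first by left.
  by have [?|B2w] := pselect (B2 w); right; [left|right; split => // -[]].
have mex u H : 0 <= u -> measurable_fun H (fun w => (excess K (L u w))%:E).
  move=> u0; apply/measurable_EFinP/measurable_funTS; apply: measurableT_comp; first exact: measurable_excess.
  exact: measL.
have split3 u : 0 <= u -> (\int[P]_(w in G) (excess K (L u w))%:E =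
   \int[P]_(w in G `&` B1) (excess K (L u w))%:E + (\int[P]_(w in G `&` B2) (excess K (L u w))%:E +
   \int[P]_(w in G `\` (B1 `|` B2)) (excess K (L u w))%:E))%E.
  move=> u0; rewrite {1}GE ge0_integral_setU//; [|exact: mF|by apply: measurableU; exact: mF|exact: mex|by move=> *; rewrite lee_fin normr_ge0|].
    congr (_ + _)%E; rewrite ge0_integral_setU//; [exact: mF|exact: mF|exact: mex|by move=> *; rewrite lee_fin normr_ge0|].
    by apply/disj_setPS => w [[_ B2w] [_ []]]; right.
  apply/disj_setPS => w [[_ B1w] [[_ B2w]|[_ []]]]; last by left.
  by move: B1w B2w; rewrite /B1 /B2 /= => ? ?; lra.
rewrite !split3//; apply: leeD; [|apply: leeD].
- apply: (@excess_submartingale_part 1) => // [y|w [_ B1w]]; first by rewrite mul1r; case: (excess_ge y K0).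
  by rewrite excess_gt// mul1r.
- apply: (@excess_submartingale_part (-1)) => // [y|w [_ B2w]]; first by rewrite mulN1r; case: (excess_ge y K0).
  by rewrite excess_lt// mulN1r.
- rewrite integral0_eq; first by apply: integral_ge0 => w _; rewrite lee_fin normr_ge0.
  move=> w [_ /not_orP[/negP]]; rewrite -leNgt => h1 /negP; rewrite -leNgt => h2.
  by rewrite excess_eq0// h1 h2.
Qed.

Variables (rho : T -> \bar R) (st_rho : stopping_time F rho).

Let Y n := grid_stopped rho t L n.
Let Z := stopped L rho t.

Let mY n : measurable_fun setT (Y n).
Proof. by apply: (measurable_grid_stopped st_rho t0). Qed.

Let mZ : measurable_fun setT Z.
Proof. by apply: (measurable_stopped st_rho t0). Qed.

Let cvgY : \forall w \ae P, Y n w @[n --> \oo] --> Z w.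
Proof.
apply: filterS Lrc => w Lw; apply: (cvg_grid_stopped st_rho t0).
by apply: Lw; rewrite clock_ge0//; case: st_rho.
Qed.

Let mexcess K (X : T -> R) : measurable_fun setT X ->
  measurable_fun setT (fun w => (excess K (X w))%:E).
Proof.
by move=> mX; apply/measurable_EFinP; apply: measurableT_comp => //; exact: measurable_excess.
Qed.

Let excess_Y K n : 0 <= K ->
  (\int[P]_w (excess K (Y n w))%:E <= \int[P]_w (excess K (L t w))%:E)%E.
Proof.
move=> K0; rewrite !(integral_cells st_rho t0 n); first last.
- by apply/measurable_EFinP; apply: mexcess; exact: mY.
- by apply/measurable_EFinP; apply: mexcess; exact: measL.
apply: lee_sum => i _; have gi0 := grid_ge0 n i t0.
have git : grid t n i <= t by rewrite -[leRHS](gridn t n) le_grid// -ltnS.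
apply: le_trans (excess_submartingale gi0 git (cell_filtration st_rho t0 n i) K0).
rewrite le_eqVlt; apply/orP; left; apply/eqP; apply: eq_integral => w /set_mem iw.
by rewrite /Y (grid_stoppedE t0 L (ltn_ord i) iw).
Qed.

Let integral_Y n : (\int[P]_w (Y n w)%:E = \int[P]_w (L t w)%:E)%E.
Proof.
rewrite !(integral_cells st_rho t0 n)//; last exact: measL.
apply: eq_bigr => i _; have gi0 := grid_ge0 n i t0.
have git : grid t n i <= t by rewrite -[leRHS](gridn t n) le_grid// -ltnS.
rewrite -(mart gi0 git (cell_filtration st_rho t0 n i)).
by apply: eq_integral => w /set_mem iw; rewrite /Y (grid_stoppedE t0 L (ltn_ord i) iw).
Qed.

Let excess_Z K : 0 <= K ->
  (\int[P]_w (excess K (Z w))%:E <= \int[P]_w (excess K (L t w))%:E)%E.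
Proof.
move=> K0.
have -> : (\int[P]_w (excess K (Z w))%:E =
    \int[P]_w limn_einf (fun n => (excess K (Y n w))%:E))%E.
  apply: ae_eq_integral => //; first by apply: mexcess; exact: mZ.
    rewrite (_ : (fun _ => _) = (fun w => - limn_esup (fun n => - (excess K (Y n w))%:E))%E); last first.
      by apply/funext => w; rewrite (limn_esupN (fun n => (excess K (Y n w))%:E)) oppeK.
    apply: measurableT_comp => //; apply: measurable_fun_limn_esup => n.
    by apply: measurableT_comp => //; apply: mexcess; exact: mY.
  apply: filterS cvgY => w Yw _.
  have cw : (excess K (Y n w))%:E @[n --> \oo] --> (excess K (Z w))%:E.
    by apply: cvg_EFin; [exact: nearW|exact: cvg_excess].
  by rewrite is_cvg_limn_einfE; [rewrite (cvg_lim _ cw)|apply/cvg_ex; eexists; exact: cw].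
apply: le_trans (fatou _ _ _ _) _ => //.
- by move=> n; exact: mexcess.
- by move=> n w _; rewrite lee_fin normr_ge0.
rewrite limn_einf_lim; apply: lime_le; first exact: is_cvg_einfs.
apply: nearW => n; apply: le_trans (excess_Y n K0).
by apply: ereal_inf_lbound; exists n => /=.
Qed.

Let int_abs (X : T -> R) : measurable_fun setT X ->
  (\int[P]_w (excess 0 (X w))%:E <= \int[P]_w (excess 0 (L t w))%:E)%E ->
  P.-integrable setT (EFin \o X).
Proof.
move=> mX XL; apply/integrableP; split; first exact/measurable_EFinP.
apply: (@le_lt_trans _ _ (\int[P]_w (excess 0 (X w))%:E)%E).
  by rewrite le_eqVlt; apply/orP; left; apply/eqP; apply: eq_integral => w _ /=; rewrite excess0.
apply: le_lt_trans XL _; have /integrableP[_] := intL t0; apply: le_lt_trans.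
by rewrite le_eqVlt; apply/orP; left; apply/eqP; apply: eq_integral => w _ /=; rewrite excess0.
Qed.

(** The case K = 0 of the bounds above, since [excess 0 y] is |y|. *)
Lemma integrable_optional_stopping : P.-integrable setT (EFin \o Z).
Proof. by apply: int_abs; [exact: mZ|exact: (excess_Z (lexx 0))]. Qed.

Let cvg_excess_L : (\int[P]_w (excess n%:R (L t w))%:E)%E @[n --> \oo] --> 0%E.
Proof.
have small : \forall w \ae P, setT w -> (excess n%:R (L t w))%:E @[n --> \oo] --> 0%E.
  apply: aeW => w _; apply: cvg_near_cst; near=> n.
  rewrite excess_eq0// -ler_norml ltW//.
  have : (Num.bound `|L t w|)%:R <= n%:R :> R by rewrite ler_nat; near: n; exact: nbhs_infty_ge.
  by apply: lt_le_trans; exact: archi_boundP.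
have dom : \forall w \ae P, forall n, setT w ->
    (`|(excess n%:R (L t w))%:E| <= `|(L t w)%:E|)%E.
  by apply: aeW => w n _ /=; rewrite lee_fin ger0_norm ?excess_le//; exact: normr_ge0.
have [_ _] := dominated_convergence measurableT
  (fun n => mexcess n%:R (measL t0)) (measurable_cst _) small (integrable_abse (intL t0)) dom.
by rewrite integral0.
Unshelve. all: by end_near. Qed.

Let cvg_clamp_Y K : 0 <= K ->
  (\int[P]_w (clamp K (Y n w))%:E)%E @[n --> \oo] --> (\int[P]_w (clamp K (Z w))%:E)%E.
Proof.
move=> K0.
have mc (X : T -> R) : measurable_fun setT X -> measurable_fun setT (fun w => (clamp K (X w))%:E).
  by move=> mX; apply/measurable_EFinP; apply: measurableT_comp => //; exact: measurable_clamp.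
have cvg : \forall w \ae P, setT w ->
    (clamp K (Y n w))%:E @[n --> \oo] --> (clamp K (Z w))%:E.
  apply: filterS cvgY => w Yw _; apply: cvg_EFin; first exact: nearW.
  exact: cvg_clamp.
have dom : \forall w \ae P, forall n, setT w -> (`|(clamp K (Y n w))%:E| <= K%:E)%E.
  by apply: aeW => w n _ /=; rewrite lee_fin clamp_le.
by have [_ _] := dominated_convergence measurableT (fun n => mc _ (mY n)) (mc _ mZ)
  cvg (finite_measure_integrable_cst P K measurableT) dom.
Qed.

(** The means of the truncations converge by dominated convergence, and the excess
    beyond K is, at the stopping time and at its rounded versions alike, at most
    the excess of L_t. *)
Lemma optional_stopping : (\int[P]_w (Z w)%:E = \int[P]_w (L t w)%:E)%E.
Proof.
have iL := intL t0; have iZ := integrable_optional_stopping.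
have iY n : P.-integrable setT (EFin \o Y n).
  by apply: int_abs; [exact: mY|exact: (excess_Y n (lexx 0))].
have iclamp K (X : T -> R) : 0 <= K -> measurable_fun setT X ->
    P.-integrable setT (EFin \o (clamp K \o X)).
  move=> K0 mX; apply: (@le_integrable _ _ _ _ _ measurableT _ (cst K%:E)).
  - by apply/measurable_EFinP; apply: measurableT_comp => //; exact: measurable_clamp.
  - by move=> w _ /=; rewrite lee_fin (le_trans (clamp_le _ K0))// ler_norm.
  - exact: finite_measure_integrable_cst.
have iexcess K (X : T -> R) : 0 <= K -> P.-integrable setT (EFin \o X) ->
    P.-integrable setT (EFin \o (excess K \o X)).
  move=> K0 iX; apply: (@le_integrable _ _ _ _ _ measurableT _ (EFin \o X)) => //.
    by apply: mexcess; apply/measurable_EFinP; exact: measurable_int iX.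
  by move=> w _ /=; rewrite lee_fin ger0_norm ?excess_le//; exact: normr_ge0.
pose e K := \int[P]_w excess K (L t w).
have dist_clamp K (X : T -> R) : 0 <= K -> measurable_fun setT X ->
    P.-integrable setT (EFin \o X) ->
    (\int[P]_w (excess K (X w))%:E <= \int[P]_w (excess K (L t w))%:E)%E ->
    `|\int[P]_w X w - \int[P]_w clamp K (X w)| <= e K.
  move=> K0 mX iX XL; rewrite -RintegralB//; last exact: iclamp.
  apply: le_trans (le_normr_Rintegral _ _) _ => //.
    rewrite (_ : EFin \o _ = (EFin \o X) \- (EFin \o (clamp K \o X)))%E//.
    by apply: integrableB => //; exact: iclamp.
  by apply: fine_le => //; apply: integrable_fin_num => //; exact: iexcess.
have tri K n : 0 <= K -> `|\int[P]_w Z w - \int[P]_w L t w| <=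
    e K + e K + `|\int[P]_w clamp K (Y n w) - \int[P]_w clamp K (Z w)|.
  move=> K0; have -> : \int[P]_w L t w = \int[P]_w Y n w.
    by rewrite /Rintegral integral_Y.
  have hZ := dist_clamp K _ K0 mZ iZ (excess_Z K0).
  have hY := dist_clamp K _ K0 (mY n) (iY n) (excess_Y n K0).
  rewrite [`|_ - \int[P]_w clamp K (Z w)|]distrC.
  move: hZ hY; set a := Rintegral _ _ _; set b := Rintegral _ _ _.
  set a' := Rintegral _ _ _; set b' := Rintegral _ _ _.
  move=> hZ hY; rewrite (_ : a - a' = (a - b) - (a' - b') + (b - b')); last by ring.
  by rewrite (le_trans (ler_normD _ _))// lerD2r (le_trans (ler_normB _ _))// lerD.
have lim1 K : 0 <= K -> `|\int[P]_w Z w - \int[P]_w L t w| <= e K + e K.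
  move=> K0; apply/ler_addgt0Pr => r r0.
  have : \int[P]_w clamp K (Y n w) @[n --> \oo] --> \int[P]_w clamp K (Z w).
    apply: fine_cvg; rewrite fineK; first exact: cvg_clamp_Y.
    by apply: integrable_fin_num => //; exact: iclamp.
  move/cvgrPdist_lt => /(_ _ r0)[n _ /(_ n (leqnn n)) /= nr].
  by apply: le_trans (tri K n K0) _; rewrite lerD2l distrC ltW.
have e0 : e n%:R @[n --> \oo] --> 0.
  by apply: fine_cvg; exact: cvg_excess_L.
have : `|\int[P]_w Z w - \int[P]_w L t w| <= 0.
  apply/ler_addgt0Pr => r r0; rewrite add0r.
  have r20 : 0 < r / 2 by rewrite divr_gt0.
  move/cvgrPdist_lt : e0 => /(_ _ r20)[n _ /(_ n (leqnn n)) /=].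
  rewrite sub0r normrN => /(le_lt_trans (ler_norm _)) /ltW en.
  by apply: le_trans (lim1 n%:R _) _ => //; rewrite [leRHS]splitr lerD.
rewrite normr_le0 subr_eq0 => /eqP h.
by have := congr1 EFin h; rewrite /Rintegral !fineK//; exact: integrable_fin_num.
Qed.

End martingale_stopping.
End optional_stopping.

(** * Time change by an increasing process *)

Section time_change_of_a_path.
Context {R : realType}.
Variables (x : R -> R) (t : R).
Hypotheses (x0 : x 0 = 0) (xnd : forall r s, 0 <= r -> r <= s -> x r <= x s)
  (xrc : forall s, 0 <= s -> x r @[r --> s^'+] --> x s) (t0 : 0 <= t).

Definition first_time (y : R -> R) u := inf [set r | 0 <= r /\ u <= y r].

Let hit u := [set r | 0 <= r /\ u <= x r].

(** The infimum is attained by right-continuity: this is the Galois connection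
    between x and its left-continuous inverse. *)
Lemma first_time_le u s : u <= x t -> 0 <= s -> (first_time x u <= s) = (u <= x s).
Proof.
move=> ut s0.
have hi : has_inf (hit u) by split; [exists t|exists 0 => r []].
have f0 : 0 <= first_time x u by apply: lb_le_inf => [|r []//]; exists t.
apply/idP/idP => [fs|us]; last by apply: ge_inf => //; exists 0 => r [].
apply: le_trans (xnd f0 fs).
rewrite leNgt; apply/negP => xu.
have := xrc f0; move/cvgrPdist_lt => /(_ _ (eqbRL (subr_gt0 _ _) xu))[/= d d0 xd].
have [r [r0 ur] rd] := inf_adherent d0 hi.
have fr : first_time x u <= r by apply: ge_inf => //; exists 0 => r' [].
move: fr; rewrite le_eqVlt => /predU1P[fr|fr]; first by move: ur; rewrite -fr leNgt xu.
have := xd r; rewrite /= distrC ger0_norm ?subr_ge0 ?(ltW fr)// ltrBlDl => /(_ rd fr).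
rewrite distrC ger0_norm; last by rewrite subr_ge0 xnd// ltW.
by rewrite ltrBrDr subrK ltNge ur.
Qed.

Lemma first_time_itv u : 0 < u -> u <= x t -> 0 < first_time x u <= t.
Proof.
move=> u0 ut; rewrite first_time_le// ut andbT ltNge first_time_le// -ltNge.
by rewrite x0.
Qed.

End time_change_of_a_path.

Section time_change.
Context {d : measure_display} {T : measurableType d} {R : realType}.
Variables (P : probability T R) (F : R -> set (set T)).
Hypothesis hF : usual_conditions P F.

(** The whole product, negative times included, is added to the rectangles: the
    sigma-algebra below lives on all of R * T. *)
Definition predictable_generator : set (set (R * T)) :=
  [set setT] `|` predictable_rectangle F.

Definition predictable_space := g_sigma_algebraType predictable_generator.

Variables (W : R -> T -> R) (t : R).
Hypotheses (t0 : 0 <= t) (W0 : forall w, W 0 w = 0)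
  (Wnd : forall w r s, 0 <= r -> r <= s -> W r w <= W s w)
  (Wrc : forall w s, 0 <= s -> W r w @[r --> s^'+] --> W s w)
  (mW : forall s, 0 <= s -> measurable_fun setT (W s)).

Local Notation TR := (T * measurableTypeR R)%type.

(** The points whose level u is reached by W during ]a, b]. *)
Definition strip a b : set TR := [set p | W a p.1 < p.2 <= W b p.1].

(** Levels outside ]0, W_t] are sent to the time -1, which no predictable rectangle
    meets. *)
Definition time_change (p : TR) : predictable_space :=
  if p \in strip 0 t then (first_time (W ^~ p.1) p.2, p.1) else (-1, p.1).

Lemma measurable_strip a b : 0 <= a -> 0 <= b -> measurable (strip a b).
Proof.
move=> a0 b0; have mW1 s : 0 <= s -> measurable_fun setT (fun p : TR => W s p.1).
  by move=> s0; apply: (measurableT_comp (mW s0)); exact: measurable_fst.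
have m2 : measurable_fun setT (fun p : TR => p.2 : R) by exact: measurable_snd.
rewrite (_ : strip a b = [set p | W a p.1 < p.2] `&` [set p | p.2 <= W b p.1]); last first.
  by apply/seteqP; split=> p; rewrite /strip /=; [move=> /andP[]|move=> [-> ->]].
apply: measurableI.
  have := @measurable_fun_ltr _ _ _ setT (fun p : TR => W a p.1) (fun p : TR => p.2 : R) (mW1 a a0) m2 measurableT [set true] I.
  by rewrite setTI.
have := @measurable_fun_ler _ _ _ setT (fun p : TR => p.2 : R) (fun p : TR => W b p.1) m2 (mW1 b b0) measurableT [set true] I.
by rewrite setTI.
Qed.

Lemma strip_sub a b : 0 <= a -> 0 <= b -> b <= t -> strip a b `<=` strip 0 t.
Proof.
move=> a0 b0 bt p /andP[ap pb]; rewrite /strip /= W0.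
by rewrite (le_trans pb) ?Wnd// (le_lt_trans _ ap)// -(W0 p.1) Wnd.
Qed.

Lemma time_changeE p : strip 0 t p -> time_change p = (first_time (W ^~ p.1) p.2, p.1).
Proof. by move=> tp; rewrite /time_change mem_set. Qed.

Lemma first_time_leE p s : strip 0 t p -> 0 <= s ->
  (first_time (W ^~ p.1) p.2 <= s) = (p.2 <= W s p.1).
Proof.
move=> /andP[_ pt] s0.
by apply: (@first_time_le _ (W ^~ p.1) t) => //; [exact: Wnd|exact: Wrc].
Qed.

Lemma time_change_itv p : strip 0 t p -> 0 < (time_change p).1 <= t.
Proof.
move=> /[dup] tp /andP[]; rewrite W0 time_changeE// => p0 pt.
by apply: (@first_time_itv _ (W ^~ p.1) t) => //; [exact: Wnd|exact: Wrc].
Qed.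

Lemma time_change_stripE a b p : 0 <= a -> 0 <= b -> strip 0 t p ->
  (a < (time_change p).1 <= b) = (W a p.1 < p.2 <= W b p.1).
Proof.
by move=> a0 b0 tp; rewrite time_changeE//= ltNge !first_time_leE// -ltNge.
Qed.

Lemma time_change_preimage a b (E : set T) : 0 <= a -> a <= b ->
  time_change @^-1` (`]a, b] `*` E) = strip (Num.min a t) (Num.min b t) `&` (E `*` setT).
Proof.
move=> a0 ab; have b0 := le_trans a0 ab.
have mint s : 0 <= s -> 0 <= Num.min s t by move=> s0; rewrite le_min s0.
apply/seteqP; split => p.
  rewrite /= in_itv/=; have [tp|ntp] := pselect (strip 0 t p); last first.
    rewrite /time_change memNset//= => -[/andP[a1 _]].
    by have := le_lt_trans a0 a1; rewrite ltNge lerN10.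
  have /andP[_ tct] := time_change_itv tp.
  move=> [/andP[ac cb]]; rewrite [in X in X -> _]time_changeE//= => Ep; split => //.
  by rewrite /strip /= -time_change_stripE ?mint// gt_min ac le_min cb tct.
move=> [sp [Ep _]]; have tp : strip 0 t p.
  by apply: strip_sub sp; rewrite ?mint// ge_min lexx orbT.
move: (sp); rewrite /strip /= -time_change_stripE ?mint// => /andP[ac].
rewrite le_min => /andP[cb ct]; rewrite in_itv/= cb andbT.
split; last by rewrite time_changeE.
by move: ac; rewrite gt_min => /orP[//|]; rewrite ltNge ct.
Qed.

Lemma measurable_time_change : measurable_fun setT time_change.
Proof.
apply: (@measurability _ _ TR predictable_space setT time_change predictable_generator) => //.
move=> _ [B [->|[[E FE ->]|[a [b [E [a0 ab FE ->]]]]]] <-]; rewrite setTI.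
  exact: measurableT.
  rewrite (_ : _ @^-1` _ = set0)//; apply/seteqP; split => // p [/=].
  have [tp|ntp] := pselect (strip 0 t p).
    by have /andP[/gt_eqF/eqP] := time_change_itv tp.
  by rewrite /time_change memNset//= => /eqP; rewrite oppr_eq0 oner_eq0.
have mint s : 0 <= s -> 0 <= Num.min s t by move=> s0; rewrite le_min s0.
rewrite time_change_preimage//; apply: measurableI.
  by apply: measurable_strip; apply: mint => //; exact: le_trans ab.
by apply: measurableX => //; exact: (filtration_measurable hF a0).
Qed.

Let mu := (P \x (@lebesgue_measure R))%E.

(** So the image of P x Lebesgue under [time_change] is dW dP. *)
Lemma strip_measure a b (E : set T) : 0 <= a -> a <= b -> measurable E ->
  (mu (strip a b `&` (E `*` setT)) = \int[P]_(w in E) (W b w - W a w)%:E)%E.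
Proof.
move=> a0 ab mE; rewrite /mu /product_measure1 [RHS]integral_mkcond.
apply: eq_integral => w _; rewrite patchE /=.
have [wE|wE] := boolP (w \in E); last first.
  rewrite (_ : xsection _ _ = set0) ?measure0//.
  by apply/seteqP; split => // u; rewrite /xsection/= inE => -[_ [/= /mem_set]]; rewrite (negbTE wE).
rewrite (_ : xsection _ _ = `]W a w, W b w]%classic).
  rewrite lebesgue_measure_itv/= lte_fin; case: ltP => //.
  move=> ba; rewrite (_ : W b w = W a w) ?subrr//.
  by apply/eqP; rewrite eq_le ba Wnd.
apply/seteqP; split => u; rewrite /xsection/= inE in_itv/=; first by case.
by move=> h; split => //; split => //; exact: set_mem.
Qed.

Hypothesis iW : P.-integrable setT (EFin \o W t).

Lemma integral_strip a b (Z : T -> R) (C : R) : 0 <= a -> a <= b -> b <= t ->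
  measurable_fun setT Z -> (forall w, `|Z w| <= C) ->
  (\int[mu]_(p in strip a b) (Z p.1)%:E = \int[P]_w (Z w * (W b w - W a w))%:E)%E.
Proof.
move=> a0 ab bt mZ ZC.
have ms : measurable (strip a b) by apply: measurable_strip => //; exact: le_trans ab.
have mZ1 : measurable_fun setT (fun p : TR => Z p.1).
  by apply: (measurableT_comp mZ); exact: measurable_fst.
have finW s : 0 <= s -> s <= t -> P.-integrable setT (EFin \o W s).
  move=> s0 st; apply: (@le_integrable _ _ _ _ _ measurableT _ (EFin \o W t)) => //.
    by apply/measurable_EFinP; exact: mW.
  move=> w _ /=; rewrite lee_fin; have Ws : 0 <= W s w by rewrite -(W0 w) Wnd.
  by rewrite !ger0_norm ?Wnd// (le_trans Ws)// Wnd.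
have sfin : (mu (strip a b) < +oo)%E.
  rewrite -[strip a b](setIT) -setXTT strip_measure//.
  have b0 := le_trans a0 ab; have at_ := le_trans ab bt.
  have : P.-integrable setT ((EFin \o W b) \- (EFin \o W a))%E by apply: integrableB => //; exact: finW.
  by move/integrable_fin_num => /(_ measurableT); rewrite fin_numElt => /andP[].
have iZ : mu.-integrable (strip a b) (fun p => (Z p.1)%:E).
  apply: (@measurable_bounded_integrable _ _ _ mu (fun p => Z p.1)) => //.
    exact: measurable_funTS.
  by exists C; split; [exact: num_real|move=> M CM p _ /=]; rewrite (le_trans (ZC _))// ltW.
have iZ' := (integrable_mkcond (fun p => (Z p.1)%:E) ms).1 iZ.
rewrite integral_mkcond -(integral12_prod_meas1 iZ').
apply: eq_integral => w _; rewrite /fubini_F.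
transitivity (\int[lebesgue_measure]_(y in `]W a w, W b w]) (Z w)%:E)%E.
  rewrite [RHS]integral_mkcond; apply: eq_integral => y _; rewrite !patchE.
  suff -> : ((w, y) \in strip a b) = (y \in `]W a w, W b w]%classic) by [].
  by apply/idP/idP; rewrite !inE /strip.
rewrite integral_cst// [X in (_ * X)%E](@lebesgue_measure_itv R `]W a w, W b w])/= lte_fin -EFinB.
case: ltP => [//|ba].
by rewrite (_ : W b w = W a w) ?subrr ?mulr0 ?mule0//; apply/eqP; rewrite eq_le ba Wnd.
Qed.

End time_change.

(** * The function of the chain rule *)

Section chain_rule_kernel.
Context {R : realType}.
Implicit Types a b y : R.

(** This is y^2 / (1 + y^2), which is bounded and vanishes at 0 only.  Its
    difference quotient is a polynomial in the two bounded functions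
    1 / (1 + y^2) and y / (1 + y^2) at a and b, hence bounded and Lipschitz. *)
Definition bump y := 1 - (1 + y ^+ 2)^-1.
Definition bump_beta y := (1 + y ^+ 2)^-1.
Definition bump_alpha y := y * (1 + y ^+ 2)^-1.
Definition bump_quotient a b := bump_alpha a * bump_beta b + bump_beta a * bump_alpha b.

Let den_gt0 y : 0 < 1 + y ^+ 2.
Proof. by rewrite ltr_pwDl// sqr_ge0. Qed.

Let den_neq0 y : 1 + y ^+ 2 != 0.
Proof. by rewrite gt_eqF. Qed.

Lemma bump_quotientE a b : bump b - bump a = bump_quotient a b * (b - a).
Proof.
rewrite /bump /bump_quotient /bump_alpha /bump_beta; field.
by rewrite !den_neq0.
Qed.

Lemma bump0 : bump 0 = 0.
Proof. by rewrite /bump expr0n /= addr0 invr1 subrr. Qed.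

Lemma bump_ge0 y : 0 <= bump y.
Proof. by rewrite /bump subr_ge0 invf_le1// lerDl sqr_ge0. Qed.

Lemma bump_eq0 y : bump y = 0 -> y = 0.
Proof.
move=> /eqP; rewrite /bump subr_eq0 eq_sym invr_eq1 -[X in _ == X]addr0.
by rewrite (inj_eq (addrI _)) sqrf_eq0 => /eqP.
Qed.

Lemma bump_le1 y : bump y <= 1.
Proof. by rewrite /bump gerBl invr_ge0 ltW. Qed.

Lemma bump_beta_bounds y : 0 < bump_beta y <= 1.
Proof. by rewrite /bump_beta invr_gt0 den_gt0 invf_le1// lerDl sqr_ge0. Qed.

Lemma bump_alpha_le y : `|bump_alpha y| <= 1 / 2.
Proof.
rewrite /bump_alpha normrM normfV [`|1 + _|]ger0_norm ?(ltW (den_gt0 _))//.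
rewrite ler_pdivrMr// mulrAC ler_pdivlMr// mul1r.
have := sqr_ge0 (`|y| - 1); rewrite sqrrB1 real_normK ?num_real//.
by rewrite -mulr_natr; lra.
Qed.

Lemma bump_quotient_le1 a b : `|bump_quotient a b| <= 1.
Proof.
have /andP[ba0 ba1] := bump_beta_bounds a; have /andP[bb0 bb1] := bump_beta_bounds b.
have ha := bump_alpha_le a; have hb := bump_alpha_le b.
rewrite /bump_quotient (le_trans (ler_normD _ _))//.
rewrite (normrM (bump_alpha a)) (normrM (bump_beta a)).
rewrite [`|bump_beta a|]ger0_norm ?(ltW ba0)// [`|bump_beta b|]ger0_norm ?(ltW bb0)//.
have := ler_pM (normr_ge0 _) (ltW bb0) ha bb1.
by have := ler_pM (ltW ba0) (normr_ge0 _) ba1 hb; lra.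
Qed.

Lemma bump_quotient_lipschitz a b b' : `|bump_quotient a b - bump_quotient a b'| <= 2 * `|b - b'|.
Proof.
have /andP[ba0 ba1] := bump_beta_bounds a; have ha := bump_alpha_le a.
have /andP[bb0 bb1] := bump_beta_bounds b; have /andP[bc0 bc1] := bump_beta_bounds b'.
have hb := bump_alpha_le b; have hc := bump_alpha_le b'.
have -> : bump_quotient a b - bump_quotient a b' = (b - b') *
    (bump_beta a * (bump_beta b * bump_beta b' - bump_alpha b * bump_alpha b')
     - bump_alpha a * (bump_alpha b * bump_beta b' + bump_beta b * bump_alpha b')).
  by rewrite /bump_quotient /bump_alpha /bump_beta; field; rewrite !den_neq0.
rewrite normrM [leRHS]mulrC ler_wpM2l//.
move: ha hb hc; rewrite !ler_norml => /andP[? ?] /andP[? ?] /andP[? ?].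
set u := bump_beta b * _ - _; set v := bump_alpha b * _ + _.
have hu : `|u| <= 5 / 4 by rewrite ler_norml; apply/andP; split; rewrite /u; nra.
have hv : `|v| <= 1 by rewrite ler_norml; apply/andP; split; rewrite /v; nra.
by move: hu hv; rewrite !ler_norml => /andP[? ?] /andP[? ?]; apply/andP; split; nra.
Qed.

Lemma measurable_bump_beta : measurable_fun setT bump_beta.
Proof.
apply: continuous_measurable_fun => y; apply: cvgV; first exact: den_neq0.
by apply: cvgD; [exact: cvg_cst|exact: exprn_continuous].
Qed.

Lemma measurable_bump_alpha : measurable_fun setT bump_alpha.
Proof. by apply: measurable_funM => //; exact: measurable_bump_beta. Qed.

Lemma measurable_bump_quotient d (S : measurableType d) (D : set S) (f g : S -> R) :
  measurable_fun D f -> measurable_fun D g ->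
  measurable_fun D (fun z => bump_quotient (f z) (g z)).
Proof.
move=> mf mg; apply: measurable_funD; apply: measurable_funM.
- exact: (measurableT_comp measurable_bump_alpha mf).
- exact: (measurableT_comp measurable_bump_beta mg).
- exact: (measurableT_comp measurable_bump_beta mf).
- exact: (measurableT_comp measurable_bump_alpha mg).
Qed.

Lemma measurable_bump : measurable_fun setT bump.
Proof. by apply: measurable_funB => //; exact: measurable_bump_beta. Qed.

End chain_rule_kernel.

(** * Total variation *)

Section total_variation_paths.
Context {R : realType}.
Variable x : R -> R.
Hypothesis xfv : finite_variation_path x.
Hypothesis xrc : forall s, 0 <= s -> x r @[r --> s^'+] --> x s.

Definition variation_path (y : R -> R) s := fine (total_variation 0 s y).
Let V := variation_path x.

Let Vfin s : 0 <= s -> total_variation 0 s x \is a fin_num.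
Proof. by move=> s0; apply/(bounded_variationP _ s0); exact: xfv. Qed.

Lemma variation_path0 : V 0 = 0.
Proof. by rewrite /V /variation_path total_variationxx. Qed.

Lemma variation_path_ge r s : 0 <= r -> r <= s -> `|x s - x r| <= V s - V r.
Proof.
move=> r0 rs; have s0 := le_trans r0 rs.
rewrite -lee_fin EFinB /V /variation_path !fineK ?Vfin//.
rewrite (total_variationD x r0 rs) [X in (_ <= X - _)%E]addeC addeK ?Vfin//.
exact: total_variation_ge.
Qed.

Lemma variation_path_nd r s : 0 <= r -> r <= s -> V r <= V s.
Proof.
by move=> r0 rs; rewrite -subr_ge0 (le_trans _ (variation_path_ge r0 rs)).
Qed.

Lemma variation_path_rc s : 0 <= s -> V r @[r --> s^'+] --> V s.
Proof.
move=> s0; have s1 : s < s + 1 by rewrite ltrDl.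
apply: (total_variation_right_continuous s0 s1 (xrc s0)).
by apply: xfv; rewrite addr_ge0.
Qed.

(** Grid points are capped at b, so that the same grid of [0, s] measures the
    variation over every [0, b] with b <= s. *)
Definition grid_variation (y : R -> R) s n b :=
  \sum_(k < n.+1) `|y (Num.min (grid s n k.+1) b) - y (Num.min (grid s n k) b)|.

Lemma grid_variation_le s n : 0 <= s -> grid_variation x s n s <= V s.
Proof.
move=> s0.
have gs k : (k <= n.+1)%N -> Num.min (grid s n k) s = grid s n k.
  by move=> kn; rewrite min_l// -[leRHS](gridn s n) le_grid.
apply: (@le_trans _ _ (\sum_(0 <= k < n.+1) (V (grid s n k.+1) - V (grid s n k)))).
  rewrite big_mkord; apply: ler_sum => k _; rewrite !gs//; last exact: ltnW.
  by apply: variation_path_ge; [exact: grid_ge0|exact: le_grid].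
by rewrite telescope_sumr// gridn grid0 variation_path0 subr0.
Qed.

(** Moving the cap from a to c adds |x c - x a|, up to twice the increment over
    the rest of the cell of a, since that cell is cut at a before and not after. *)
Let grid_variation_step s a c n j : 0 <= s -> a < c -> c <= s -> (j < n.+1)%N ->
  grid s n j <= a < grid s n j.+1 ->
  grid_variation x s n a + `|x c - x a| - 2 * `|x (Num.min (grid s n j.+1) c) - x a|
    <= grid_variation x s n c.
Proof.
move=> s0 ac cs jn /andP[ja aj]; set g := grid s n; set eta := `|x (Num.min _ _) - _|.
pose u k := x (Num.min (g k) c); pose v k := x (Num.min (g k) a).
have ua k : (k <= j)%N -> u k = v k.
  move=> kj; have ga : g k <= a by apply: le_trans ja; exact: le_grid.
  by rewrite /u /v !min_l// (le_trans ga)// ltW.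
have va k : (j < k)%N -> v k = x a.
  by move=> jk; rewrite /v min_r// (le_trans (ltW aj))// le_grid.
(* The samplings of x capped at c and at a differ by 0 at the first grid point and by
   x c - x a at the last. *)
have tele : `|x c - x a| <= \sum_(k < n.+1) `|(u k.+1 - v k.+1) - (u k - v k)|.
  apply: le_trans (ler_norm_sum _ _ _).
  rewrite -(big_mkord xpredT (fun k => (u k.+1 - v k.+1) - (u k - v k))).
  rewrite (@telescope_sumr _ 0 n.+1 (fun k => u k - v k))// (ua 0%N)// subrr subr0.
  by rewrite /u /v /g gridn min_r// min_r// (le_trans (ltW ac)).
have etaE : \sum_(k < n.+1) (if k == j :> nat then 2 * eta else 0) = 2 * eta.
  rewrite (bigD1 (Ordinal jn))//= eqxx big1 ?addr0// => k.
  by rewrite -val_eqE /= => /negbTE ->.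
suff : \sum_(k < n.+1) `|(u k.+1 - v k.+1) - (u k - v k)| -
    \sum_(k < n.+1) (if k == j :> nat then 2 * eta else 0) <=
    grid_variation x s n c - grid_variation x s n a.
  by move: tele; rewrite etaE; lra.
rewrite /grid_variation -!sumrB; apply: ler_sum => k _; rewrite -/g -!/(u _) -!/(v _).
have [kj|jk|->] := ltngtP k j.
- by rewrite !ua ?(ltnW kj)//; rewrite !subrr subr0 normr0.
- rewrite (va k.+1) ?(ltn_trans jk)// (va k)// subrr normr0.
  by have -> : u k.+1 - x a - (u k - x a) = u k.+1 - u k by ring.
- rewrite (va j.+1)// (ua j)// subrr subr0.
  have -> : `|u j.+1 - x a| = eta by [].
  have := ler_normB (u j.+1 - x a) (u j.+1 - v j).
  rewrite (_ : u j.+1 - x a - (u j.+1 - v j) = - (x a - v j)); last by ring.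
  by rewrite normrN -/eta; lra.
Qed.

Lemma grid_variation_near s a c e : 0 <= a -> a < c -> c <= s -> 0 < e ->
  \forall n \near \oo,
    grid_variation x s n a + `|x c - x a| - e <= grid_variation x s n c.
Proof.
move=> a0 ac cs e0; have s0 : 0 < s by apply: lt_le_trans cs; exact: le_lt_trans ac.
have e20 : 0 < e / 2 by rewrite divr_gt0.
move/cvgrPdist_lt : (xrc a0) => /(_ _ e20)[r /= r0 xr].
move/cvgrPdist_lt : (cvg_grid_mesh s) => /(_ _ r0); apply: filterS => n.
rewrite sub0r normrN ger0_norm ?divr_ge0 ?(ltW s0)// => nr.
have [j jn ja] : exists2 j, (j < n.+1)%N & grid s n j <= a < grid s n j.+1.
  have ex : exists j, a < grid s n j by exists n.+1; rewrite gridn (lt_le_trans ac).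
  case: (ex_minnP ex) => -[|j] aj jmin; first by move: aj; rewrite grid0 ltNge a0.
  exists j; first by apply: jmin; rewrite gridn (lt_le_trans ac).
  by rewrite aj andbT leNgt; apply/negP => /jmin; rewrite ltnn.
have := grid_variation_step (ltW s0) ac cs jn ja.
suff : `|x (Num.min (grid s n j.+1) c) - x a| <= e / 2 by lra.
have /andP[ja1 aj] := ja.
rewrite distrC ltW//; apply: xr; last by rewrite lt_min aj.
rewrite /= distrC ger0_norm ?subr_ge0 ?le_min ?(ltW aj) ?(ltW ac)//.
rewrite ltrBlDl (@le_lt_trans _ _ (grid s n j.+1)) ?ge_min ?lexx//.
by rewrite gridS ler_ltD.
Qed.

(** A partition is compared with the fine grids one point after the other; by
    right-continuity each point costs an error that vanishes with the mesh.  The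
    point of using deterministic grids is the measurability of the variation of a
    process. *)
Lemma cvg_grid_variation s : 0 <= s -> grid_variation x s n s @[n --> \oo] --> V s.
Proof.
rewrite le_eqVlt => /predU1P[<-|s0].
  apply: cvg_near_cst; apply: nearW => n; rewrite variation_path0 /grid_variation.
  by rewrite big1// => k _; rewrite /grid !mul0r subrr normr0.
have part l a e : 0 <= a -> itv_partition a s l -> 0 < e ->
    \forall n \near \oo, grid_variation x s n a + variation a s x l - e <=
      grid_variation x s n s.
  elim: l a e => [a e _ /itv_partition_nil -> e0|c l ih a e a0 acl e0].
    by apply: nearW => n; rewrite variation_nil; lra.
  have e20 : 0 < e / 2 by rewrite divr_gt0.
  have ac : a < c by case: acl => /= /andP[].
  have cl := itv_partition_cons acl; have cs := itv_partition_le cl.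
  have c0 := le_trans a0 (ltW ac).
  near=> n.
  have h1 : grid_variation x s n a + `|x c - x a| - e / 2 <= grid_variation x s n c.
    by near: n; exact: grid_variation_near.
  have h2 : grid_variation x s n c + variation c s x l - e / 2 <= grid_variation x s n s.
    by near: n; exact: ih.
  suff : variation a s x (c :: l) = `|x c - x a| + variation c s x l by lra.
  by rewrite /variation /= big_nat_recl.
apply/cvgrPdist_le => e e0; have e20 : 0 < e / 2 by rewrite divr_gt0.
have [l sl Vl] : exists2 l, itv_partition 0 s l & V s - e / 2 < variation 0 s x l.
  have := @ub_ereal_sup_adherent R _ _ e20 (Vfin (ltW s0)).
  case=> _ [_ [l sl <-] <-]; rewrite -/(total_variation 0 s x).
  by rewrite -(fineK (Vfin (ltW s0))) -EFinB lte_fin => h; exists l.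
near=> n; rewrite ger0_norm ?subr_ge0 ?grid_variation_le ?(ltW s0)//.
have : grid_variation x s n 0 + variation 0 s x l - e / 2 <= grid_variation x s n s.
  by near: n; exact: part.
have : 0 <= grid_variation x s n 0 by apply: sumr_ge0.
by move: Vl; lra.
Unshelve. all: by end_near. Qed.

End total_variation_paths.

(** * Stopping times and stopped processes *)

Section stopped_paths.
Context {d : measure_display} {T : measurableType d} {R : realType}.
Variables (P : probability T R) (F : R -> set (set T)).
Hypothesis hF : usual_conditions P F.
Implicit Types (rho : T -> \bar R) (X : R -> T -> R).

Lemma clock_id rho t r w : (0 <= rho w)%E -> r <= clock rho t w -> clock rho r w = r.
Proof.
move=> rho0; rewrite -lee_fin clockE// le_min => /andP[_ rrho].
by apply/EFin_inj; rewrite clockE// min_l.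
Qed.

Lemma clock_clock rho t w : (0 <= rho w)%E -> clock rho (clock rho t w) w = clock rho t w.
Proof. by move=> rho0; apply: (clock_id (t := t)). Qed.

Lemma stopped_rc X rho w : (0 <= rho w)%E ->
  (forall s, 0 <= s -> X r w @[r --> s^'+] --> X s w) ->
  forall s, 0 <= s -> stopped X rho r w @[r --> s^'+] --> stopped X rho s w.
Proof.
move=> rho0 Xrc s s0; rewrite stoppedE.
have [rhos|srho] := leP (rho w) s%:E.
  apply: cvg_near_cst; near=> r; rewrite stoppedE; congr (X _ w).
  have sr : s <= r by near: r; exact: nbhs_right_ge.
  apply/EFin_inj; rewrite !clockE// !min_r//.
  by rewrite (le_trans rhos)// lee_fin.
have -> : clock rho s w = s by apply/EFin_inj; rewrite clockE// min_l// ltW.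
apply: cvg_trans (Xrc s s0); apply: near_eq_cvg.
have [b sb brho] : exists2 b, s < b & (b%:E <= rho w)%E.
  move: srho; case: (rho w) => [b| |//]; first by rewrite lte_fin => ?; exists b.
  by move=> _; exists (s + 1); rewrite ?ltrDl ?leey.
near=> r; rewrite stoppedE; congr (X _ w); apply/EFin_inj; rewrite clockE// min_l//.
by rewrite (le_trans _ brho)// lee_fin; near: r; exact: nbhs_right_le.
Unshelve. all: by end_near. Qed.

Lemma stopping_time_min rho sigma : stopping_time F rho -> stopping_time F sigma ->
  stopping_time F (fun w => Order.min (rho w) (sigma w)).
Proof.
move=> [rho0 rhoF] [sigma0 sigmaF]; split => [w|t t0]; first by rewrite le_min rho0 sigma0.
rewrite (_ : [set _ | _] = [set w | (rho w <= t%:E)%E] `|` [set w | (sigma w <= t%:E)%E]).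
  by apply: (filtrationU hF) => //; [exact: rhoF|exact: sigmaF].
by apply/seteqP; split => w /=; rewrite ge_min => /orP.
Qed.

(** Comparing the stopping time below with rho gives the martingale property
    between a and t out of the mean of the stopped process alone. *)
Lemma stopping_time_restrict rho a (E : set T) : stopping_time F rho -> 0 <= a -> F a E ->
  stopping_time F (fun w => if w \in E then Order.min a%:E (rho w) else rho w).
Proof.
move=> [rho0 rhoF] a0 FE; split => [w|t t0].
  by case: ifPn => _ //; rewrite le_min rho0 lee_fin a0.
have [at_|ta] := leP a t.
  rewrite (_ : [set _ | _] = E `|` [set w | (rho w <= t%:E)%E]).
    apply: (filtrationU hF) => //; last exact: rhoF.
    exact: (filtration_nondecreasing hF a0 at_).
  apply/seteqP; split => w /=.
    by case: ifPn => [/set_mem|_]; [left|right].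
  case: ifPn => [_ _|/negP wE [/mem_set//|//]]; by rewrite ge_min lee_fin at_.
rewrite (_ : [set _ | _] = [set w | (rho w <= t%:E)%E]); first exact: rhoF.
by apply/seteqP; split => w /=; case: ifPn => _ //; rewrite ge_min lee_fin [a <= t]leNgt ta.
Qed.

Section first_passage.
Variable V : R -> T -> R.
Hypotheses (Vnd : forall w r s, 0 <= r -> r <= s -> V r w <= V s w)
  (Vrc : forall w s, 0 <= s -> V r w @[r --> s^'+] --> V s w)
  (mV : forall s, 0 <= s -> measurable_wrt (F s) (V s)).

Definition first_passage (k : R) w : \bar R :=
  ereal_inf [set s%:E | s in [set s | 0 <= s /\ k <= V s w]].

(** The level k is reached at the first passage, by right-continuity. *)
Lemma first_passage_leE k w t : 0 <= t ->
  (first_passage k w <= t%:E)%E = (k <= V t w).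
Proof.
move=> t0; apply/idP/idP => [|kV]; last first.
  by apply: ereal_inf_lbound; exists t.
apply: contraLR; rewrite -!ltNge => Vk.
have : \forall r \near t^'+, V r w < k.
  by move/cvgr_lt : (@Vrc w t t0); exact.
move=> [/= e e0 Ve].
have e20 : 0 < e / 2 by rewrite divr_gt0.
apply: (@lt_le_trans _ _ (t + e / 2)%:E); first by rewrite lte_fin ltrDl.
apply: le_ereal_inf_tmp => _ [s [s0 ks] <-]; rewrite lee_fin leNgt; apply/negP => st.
have : V s w < k.
  apply: (@le_lt_trans _ _ (V (t + e / 2) w)); first by rewrite Vnd// ltW.
  by apply: Ve; rewrite /= ?ltrDl// opprD addrA subrr sub0r normrN gtr0_norm//; lra.
by rewrite ltNge ks.
Qed.

Lemma first_passage_stopping k : stopping_time F (first_passage k).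
Proof.
split => [w|t t0]; first by apply: le_ereal_inf_tmp => _ [s [s0 _] <-]; rewrite lee_fin.
rewrite (_ : [set _ | _] = V t @^-1` `[k, +oo[%classic); first exact: mV.
by apply/seteqP; split => w /=; rewrite in_itv/= andbT first_passage_leE.
Qed.

End first_passage.

Lemma measurable_variation (N : R -> T -> R) t : adapted F N ->
  (forall w s, 0 <= s -> N r w @[r --> s^'+] --> N s w) ->
  (forall w, finite_variation_path (N ^~ w)) -> 0 <= t ->
  measurable_wrt (F t) (fun w => variation_path (N ^~ w) t).
Proof.
move=> Nad Nrc Nfv t0; apply/(measurable_wrtP hF _ t0).
apply: (@measurable_fun_cvg _ (filtration_space F t) _ _ (fun n w => grid_variation (N ^~ w) t n t)) => [n|w _].
  apply: measurable_sum => k; apply: measurableT_comp => //.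
  have mNs s : 0 <= s -> s <= t -> measurable_fun (setT : set (filtration_space F t)) (N s).
    move=> s0 st; apply/(measurable_wrtP hF _ t0) => B mB.
    by apply: (filtration_nondecreasing hF s0 st); exact: Nad.
  by apply: measurable_funB; apply: mNs; rewrite ?le_min ?grid_ge0 ?ge_min ?lexx ?orbT.
by apply: cvg_grid_variation => //; exact: Nrc.
Qed.

(** The variation before c is at most k, so |x| <= k there, and the jump at c is at
    most |x c| + k. *)
Lemma variation_overshoot (x : R -> R) c k : finite_variation_path x ->
  (forall s, 0 <= s -> x r @[r --> s^'+] --> x s) -> x 0 = 0 -> 0 <= k -> 0 <= c ->
  (forall r, 0 <= r -> r < c -> variation_path x r < k) ->
  variation_path x c <= 2 * k + `|x c|.
Proof.
move=> xfv xrc x0 k0; rewrite le_eqVlt => /predU1P[<- _|c0 Vk].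
  by rewrite variation_path0 addr_ge0// mulr_ge0.
have cv := cvg_grid_variation xfv xrc (ltW c0).
rewrite -(cvg_lim _ cv)//; apply: limr_le; first by apply/cvg_ex; eexists; exact: cv.
apply: nearW => n; rewrite /grid_variation big_ord_recr/=.
have gc : grid c n n < c.
  by rewrite -[ltRHS](gridn c n) gridS ltrDl divr_gt0.
have g0 := grid_ge0 n n (ltW c0).
rewrite gridn minxx [Num.min _ c]min_l ?(ltW gc)//.
have Vg := Vk _ g0 gc.
have h1 : \sum_(i < n) `|x (Num.min (grid c n i.+1) c) - x (Num.min (grid c n i) c)| <= k.
  apply: le_trans (ltW Vg).
  apply: (@le_trans _ _ (\sum_(0 <= i < n) (variation_path x (grid c n i.+1) - variation_path x (grid c n i)))).
    rewrite big_mkord; apply: ler_sum => i _.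
    have gs j : (j <= n)%N -> Num.min (grid c n j) c = grid c n j.
      by move=> jn; rewrite min_l// (le_trans _ (ltW gc))// le_grid// ltW.
    rewrite !gs//; last exact: ltnW.
    by apply: variation_path_ge => //; [exact: grid_ge0 (ltW c0)|apply: le_grid (ltW c0) _ _ _].
  by rewrite telescope_sumr// grid0 variation_path0 subr0.
have h2 : `|x c - x (grid c n n)| <= `|x c| + k.
  rewrite (le_trans (ler_normB _ _))// lerD2l.
  have := variation_path_ge xfv (lexx 0) g0.
  by rewrite x0 subr0 variation_path0 subr0 => /le_trans; apply; exact: ltW.
by lra.
Qed.

End stopped_paths.

(** * The chain rule along a grid *)

Section chain_rule.
Context {d : measure_display} {T : measurableType d} {R : realType}.
Variables (P : probability T R) (F : R -> set (set T)).
Hypothesis hF : usual_conditions P F.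
Local Notation TR := (T * measurableTypeR R)%type.

Variables (N : R -> T -> R) (rho : T -> \bar R) (t : R).
Hypotheses (Nad : adapted F N)
  (Nrc : forall w s, 0 <= s -> N r w @[r --> s^'+] --> N s w)
  (Npr : measurable_fun ([set p | 0 <= p.1] : set (predictable_space F)) (fun p : predictable_space F => N p.1 p.2))
  (st_rho : stopping_time F rho) (t0 : 0 < t).

Local Notation g := (grid t).

Definition time_cell n k : set (predictable_space F) := `]g n k, g n k.+1]%classic `*` setT.

(** The quotient between N at a grid point and N at a later time of the cell; this
    is a predictable function, contrary to the quotient between two consecutive
    grid points, which looks into the future. *)
Definition step_quotient n k (q : predictable_space F) : R := bump_quotient (N (g n k) q.2) (N q.1 q.2).

Definition stopped_quotient n k w :=
  bump_quotient (stopped N rho (g n k) w) (stopped N rho (g n k.+1) w).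

Let g0 n k : 0 <= g n k. Proof. exact: grid_ge0 (ltW t0). Qed.
Let gS n k : g n k <= g n k.+1. Proof. by apply: le_grid (ltW t0) _ _ _. Qed.
Let gt n k : (k < n.+2)%N -> g n k <= t.
Proof. by move=> kn; rewrite -[leRHS](gridn t n) le_grid// ltW. Qed.

Lemma measurable_rectangle a b (E : set T) : 0 <= a -> a <= b -> F a E ->
  measurable (`]a, b]%classic `*` E : set (predictable_space F)).
Proof.
by move=> a0 ab FE; apply: sub_sigma_algebra; right; right; exists a, b, E.
Qed.

Lemma measurable_nonneg_event (E : set T) : F 0 E ->
  measurable ([set p | 0 <= p.1 /\ E p.2] : set (predictable_space F)).
Proof.
move=> FE.
rewrite (_ : [set _ | _] = ([set 0] `*` E : set (predictable_space F)) `|`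
    \bigcup_n (`]0, n%:R]%classic `*` E : set (predictable_space F))).
  apply: measurableU; last apply: bigcupT_measurable => n.
    by apply: sub_sigma_algebra; right; left; exists E.
  exact: measurable_rectangle.
apply/seteqP; split => [q /= []|q [[/= q0 Eq]|[n _ [/=]]]]; last 2 first.
- by rewrite q0.
- by rewrite in_itv/= => /andP[/ltW].
rewrite le_eqVlt => /predU1P[<-|q0] Eq; first by left.
right; exists (Num.bound q.1) => //; split => //=.
by rewrite in_itv/= q0 ltW// archi_boundP// ltW.
Qed.

Lemma measurable_nonneg_time : measurable ([set p | 0 <= p.1] : set (predictable_space F)).
Proof.
rewrite (_ : [set _ | _] = [set p | 0 <= p.1 /\ setT p.2]); last first.
  by apply/seteqP; split => p // -[].
by apply: measurable_nonneg_event; exact: (filtrationT hF).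
Qed.

Lemma measurable_time_cell n k : measurable (time_cell n k).
Proof. by apply: measurable_rectangle => //; exact: (filtrationT hF). Qed.

Lemma measurable_step_quotient n k : measurable_fun (time_cell n k) (step_quotient n k).
Proof.
apply: measurable_bump_quotient.
- move=> _ B mB; rewrite (_ : _ `&` _ = `]g n k, g n k.+1]%classic `*` (N (g n k) @^-1` B)).
    by apply: measurable_rectangle => //; exact: Nad.
  by apply/seteqP; split => q; rewrite /time_cell /=; [case=> -[]|case].
- apply: measurable_funS Npr; first exact: measurable_nonneg_time.
  by move=> q [/=]; rewrite in_itv/= => /andP[/ltW /(le_trans (g0 n k))].
Qed.

Variable W : R -> T -> R.
Hypotheses (W0 : forall w, W 0 w = 0)
  (Wnd : forall w r s, 0 <= r -> r <= s -> W r w <= W s w)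
  (Wrc : forall w s, 0 <= s -> W r w @[r --> s^'+] --> W s w)
  (mW : forall s, 0 <= s -> measurable_fun setT (W s))
  (iW : P.-integrable setT (EFin \o W t))
  (Wclock : forall w, W (clock rho t w) w = W t w).

Let phi : TR -> predictable_space F := time_change F W t.
Let mu := (P \x (@lebesgue_measure R))%E.
Let S := strip W 0 t.

Let mphi : measurable_fun setT phi.
Proof. by apply: (measurable_time_change hF) => //; exact: ltW. Qed.

Let mS : measurable S.
Proof. by apply: measurable_strip => //; exact: ltW. Qed.

Let phi_clock p : S p -> 0 < (phi p).1 <= clock rho t p.1.
Proof.
move=> Sp; have /andP[-> _] := time_change_itv F (ltW t0) W0 Wnd Wrc Sp.
rewrite /phi time_changeE//= (first_time_leE (ltW t0) Wnd Wrc Sp).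
  by rewrite Wclock; case/andP: Sp.
by apply: clock_ge0 (ltW t0) _; case: st_rho.
Qed.

Let phi2 p : S p -> (phi p).2 = p.1.
Proof. by move=> Sp; rewrite /phi time_changeE. Qed.

Let strip_cell n k p : (k < n.+1)%N -> strip W (g n k) (g n k.+1) p ->
  S p /\ g n k < (phi p).1 <= g n k.+1.
Proof.
move=> kn kp; have Sp : S p by apply: (strip_sub W0 Wnd _ _ _ kp) => //; exact: gt.
by split => //; rewrite /phi time_change_stripE// ltW.
Qed.

Lemma time_cell_preimage n k : (k < n.+1)%N -> phi @^-1` time_cell n k = strip W (g n k) (g n k.+1).
Proof.
move=> kn; rewrite /phi /time_cell time_change_preimage//; last exact: ltW.
by rewrite !min_l ?gt// ?setXTT ?setIT// ltnW.
Qed.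

(** The minimum of the two bounds on the difference of the quotients: the second,
    from the Lipschitz property, tends to 0, and the first makes the convergence
    dominated. *)
Definition quotient_error n (p : TR) : R :=
  Num.min 2 (2 * `|step t n (fun k => stopped N rho (g n k.+1) p.1) (phi p).1 - N (phi p).1 p.1|).

Let quotient_error_bounds n p : 0 <= quotient_error n p <= 2.
Proof. by rewrite /quotient_error le_min ge_min lexx ler0n mulr_ge0. Qed.

Let stopped_step_quotient n k p : (k < n.+1)%N -> strip W (g n k) (g n k.+1) p ->
  `|stopped_quotient n k p.1 - step_quotient n k (phi p)| <= quotient_error n p.
Proof.
move=> kn /(strip_cell kn)[Sp /andP[gp pg]].
have rho0 : (0 <= rho p.1)%E by case: st_rho.
have /andP[_ pc] := phi_clock Sp.
rewrite /quotient_error (stepE _ (ltW t0) kn) ?gp//.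
rewrite /stopped_quotient /step_quotient phi2// [stopped N rho (g n k) _]stoppedE.
rewrite (clock_id (t := t) rho0); last by rewrite (le_trans (ltW gp)).
rewrite le_min bump_quotient_lipschitz andbT.
by rewrite (le_trans (ler_normB _ _))// (_ : 2 = 1 + 1)// lerD// bump_quotient_le1.
Qed.

Let measurable_stopped_N s : 0 <= s -> measurable_fun setT (stopped N rho s).
Proof.
move=> s0; apply: (measurable_stopped hF st_rho s0).
  by move=> r r0; apply: (measurable_wrt_measurable hF r0); exact: Nad.
by apply: aeW => w r r0; exact: Nrc.
Qed.

Let measurable_quotient_error n : measurable_fun S (quotient_error n).
Proof.
apply: measurable_minr => //; apply: measurable_funM => //.
apply: measurableT_comp => //; apply: measurable_funB.
  apply: measurable_funTS; apply: measurable_sum => k; apply: measurable_funM.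
    rewrite (_ : (fun _ => _) = (\1_(time_cell n k) : _ -> R) \o phi).
      by apply: measurableT_comp mphi; apply: measurable_indic; exact: measurable_time_cell.
    apply/funext => p /=; rewrite !indicE; congr (_%:R); congr nat_of_bool.
    by apply/idP/idP; rewrite !inE /time_cell /=; [|case].
  apply: (measurableT_comp (measurable_stopped_N (g0 n k.+1))); exact: measurable_fst.
have mN : measurable_fun S (fun p => N (phi p).1 (phi p).2).
  apply: (measurable_comp measurable_nonneg_time) Npr _ => [q [p Sp <-]|].
    by have /andP[/ltW] := phi_clock Sp.
  exact: measurable_funTS.
by apply: eq_measurable_fun mN => p /set_mem Sp; rewrite phi2.
Qed.

Let cvg_quotient_error p : S p -> quotient_error n p @[n --> \oo] --> 0.
Proof.
move=> Sp; have rho0 : (0 <= rho p.1)%E by case: st_rho.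
have /andP[p0 pc] := phi_clock Sp.
have pt : (phi p).1 <= t by rewrite (le_trans pc)// clock_le.
have := cvg_step_right p0 pt (stopped_rc rho0 (@Nrc p.1) (ltW p0)).
rewrite [X in _ --> X]stoppedE (clock_id rho0 pc) => cst.
have c0 : 2 * `|step t n (fun k => stopped N rho (g n k.+1) p.1) (phi p).1 - N (phi p).1 p.1|
    @[n --> \oo] --> 0.
  rewrite -(mulr0 2) -(normr0 R) -(subrr (N (phi p).1 p.1)).
  by apply: cvgMr; apply: cvg_norm; apply: cvgB => //; exact: cvg_cst.
apply: (squeeze_cvgr _ (cvg_cst 0) c0); apply: nearW => n.
by rewrite (andP (quotient_error_bounds n p)).1 /= ge_min lexx orbT.
Qed.

Let mu_S : (mu S < +oo)%E.
Proof.
rewrite /mu /S -[strip _ _ _](setIT) -setXTT strip_measure//; last exact: ltW.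
under eq_integral do rewrite W0 subr0.
by move/integrable_fin_num : iW => /(_ measurableT); rewrite fin_numElt => /andP[].
Qed.

Let bounded_integrable (D : set TR) (f : TR -> R) : measurable D -> D `<=` S ->
  measurable_fun D f -> (forall p, D p -> `|f p| <= 2) -> mu.-integrable D (EFin \o f).
Proof.
move=> mD DS mf f2; apply: measurable_bounded_integrable => //.
  by apply: le_lt_trans mu_S; apply: le_measure; rewrite ?inE.
by exists 2; split; [exact: num_real|move=> M M2 p Dp /=; rewrite (le_trans (f2 p Dp))// ltW].
Qed.

Let cvg_integral_error : \int[mu]_(p in S) quotient_error n p @[n --> \oo] --> 0.
Proof.
have err_cvg : \forall p \ae mu, S p -> (quotient_error n p)%:E @[n --> \oo] --> 0%E.
  by apply: aeW => p Sp; apply: cvg_EFin; [exact: nearW|exact: cvg_quotient_error].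
have dom : \forall p \ae mu, forall n, S p -> (`|(quotient_error n p)%:E| <= 2%:E)%E.
  apply: aeW => p n _ /=; have /andP[e0 e2] := quotient_error_bounds n p.
  by rewrite lee_fin ger0_norm.
have i2 : mu.-integrable S (EFin \o cst 2).
  by apply: bounded_integrable => // p _; rewrite /= ger0_norm.
have [_ _] := dominated_convergence mS
  (fun n => (measurable_EFinP _ _).2 (measurable_quotient_error n)) (measurable_cst _) err_cvg i2 dom.
by rewrite integral0 => h; apply: fine_cvg.
Qed.

Lemma integrable_step_quotient n k : (k < n.+1)%N ->
  mu.-integrable (strip W (g n k) (g n k.+1)) (EFin \o (step_quotient n k \o phi)).
Proof.
move=> kn; set D := strip _ _ _.
have mD : measurable D by exact: measurable_strip.
have DS : D `<=` S by move=> p /(strip_cell kn)[].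
have mH : measurable_fun D (step_quotient n k \o phi).
  apply: (@measurable_comp _ _ _ _ _ _ (time_cell n k)) => //.
  - exact: measurable_time_cell.
  - by rewrite /D -time_cell_preimage//; exact: image_preimage_subset.
  - exact: measurable_step_quotient.
  - exact: measurable_funTS.
apply: bounded_integrable => // p _.
by rewrite (le_trans (bump_quotient_le1 _ _))// ler1n.
Qed.

Let step_quotient_error n k : (k < n.+1)%N ->
  `|\int[P]_w (stopped_quotient n k w * (W (g n k.+1) w - W (g n k) w)) -
    \int[mu]_(p in strip W (g n k) (g n k.+1)) step_quotient n k (phi p)| <=
  \int[mu]_(p in strip W (g n k) (g n k.+1)) quotient_error n p.
Proof.
move=> kn; set D := strip _ _ _.
have mD : measurable D by exact: measurable_strip.
have DS : D `<=` S by move=> p /(strip_cell kn)[].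
have mZ : measurable_fun setT (stopped_quotient n k).
  by apply: measurable_bump_quotient; exact: measurable_stopped_N.
have -> : \int[P]_w (stopped_quotient n k w * (W (g n k.+1) w - W (g n k) w)) =
    \int[mu]_(p in D) stopped_quotient n k p.1.
  have Z1 w : `|stopped_quotient n k w| <= 1 by exact: bump_quotient_le1.
  rewrite /Rintegral; congr fine; apply/esym.
  exact: (integral_strip W0 Wnd mW iW (g0 n k) (gS n k) (@gt n k.+1 kn) mZ Z1).
have iZ : mu.-integrable D (EFin \o (fun p => stopped_quotient n k p.1)).
  apply: bounded_integrable => //; last first.
    by move=> p _; rewrite (le_trans (bump_quotient_le1 _ _))// ler1n.
  apply: measurable_funTS; apply: (measurableT_comp mZ); exact: measurable_fst.
have iH := integrable_step_quotient kn.
have ie : mu.-integrable D (EFin \o quotient_error n).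
  apply: bounded_integrable => //; first exact: measurable_funS (measurable_quotient_error n).
  by move=> p _; have /andP[? ?] := quotient_error_bounds n p; rewrite ger0_norm.
have iB : mu.-integrable D (EFin \o (fun p => stopped_quotient n k p.1 - step_quotient n k (phi p))).
  rewrite (_ : EFin \o _ = (EFin \o (fun p => stopped_quotient n k p.1)) \-
    (EFin \o (step_quotient n k \o phi)))%E//; exact: integrableB.
rewrite -RintegralB//; apply: le_trans (le_normr_Rintegral mD iB) _.
apply: le_Rintegral => //; first exact: integrable_abse iB.
by move=> p Dp; apply: stopped_step_quotient.
Qed.

(** The strips over the cells of the grid partition S, so the errors add up to the
    integral of [quotient_error] over S, which tends to 0. *)
Lemma chain_rule_approximation :
  \sum_(k < n.+1) (\int[P]_w (stopped_quotient n k w * (W (g n k.+1) w - W (g n k) w)) -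
    \int[mu]_(p in strip W (g n k) (g n k.+1)) step_quotient n k (phi p))
  @[n --> \oo] --> 0.
Proof.
apply/cvgrPdist_lt => e e0.
move/cvgrPdist_lt : cvg_integral_error => /(_ _ e0); apply: filterS => n.
rewrite !sub0r !normrN => /(le_lt_trans (ler_norm _)); apply: le_lt_trans.
apply: le_trans (ler_norm_sum _ _ _) _.
apply: (@le_trans _ _ (\sum_(k < n.+1)
    \int[mu]_(p in strip W (g n k) (g n k.+1)) quotient_error n p)).
  by apply: ler_sum => k _; exact: step_quotient_error.
have SE : S = \big[setU/set0]_(k < n.+1) strip W (g n k) (g n k.+1).
  rewrite -(bigcup_mkord n.+1 (fun k => strip W (g n k) (g n k.+1))).
  apply/seteqP; split => [p Sp|p [k /= kn /(strip_cell kn)[]]//].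
  have /andP[p0 pt] := time_change_itv F (ltW t0) W0 Wnd Wrc Sp.
  have [k kn kp] := gridP n p0 pt; exists k => //=.
  by move: kp; rewrite time_change_stripE// ltW.
have tS : trivIset [set` index_iota 0 n.+1] (fun k => strip W (g n k) (g n k.+1)).
  have lt_strip i j p : (i < j)%N -> strip W (g n i) (g n i.+1) p ->
      ~ strip W (g n j) (g n j.+1) p.
    move=> ij /andP[_ pi] /andP[pj _]; have := lt_le_trans pj pi.
    by rewrite ltNge Wnd//; apply: le_grid (ltW t0) _ _ _.
  move=> i j _ _ [p [pi pj]]; have [ij|ij|//] := ltngtP i j.
    by have := lt_strip _ _ _ ij pi pj.
  by have := lt_strip _ _ _ ij pj pi.
have me : measurable_fun S (EFin \o quotient_error n).
  by apply/measurable_EFinP; exact: measurable_quotient_error.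
rewrite [leRHS]/Rintegral {1}SE -(big_mkord xpredT (fun k => strip W (g n k) (g n k.+1))).
rewrite (@integral_bigsetU_EFin _ _ _ mu _ (fun k => strip W (g n k) (g n k.+1)))//.
- rewrite big_mkord -sum_fine// => k _; apply: integrable_fin_num; first exact: measurable_strip.
  apply: bounded_integrable; first exact: measurable_strip.
  + by move=> p /(strip_cell (ltn_ord k))[].
  + apply: measurable_funS (measurable_quotient_error n) => //.
    by move=> p /(strip_cell (ltn_ord k))[].
  + by move=> p _; have /andP[? ?] := quotient_error_bounds n p; rewrite ger0_norm.
- by move=> k; exact: measurable_strip.
- exact: iota_uniq.
- by rewrite big_mkord -SE.
Qed.

End chain_rule.

(** * Predictable martingales of finite variation *)

Section equal_images.
Context {d1 d2 : measure_display} {X : measurableType d1} {Y : measurableType d2} {R : realType}.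
Variables (mu : {measure set X -> \bar R}) (phi1 phi2 : X -> Y).
Hypotheses (mphi1 : measurable_fun setT phi1) (mphi2 : measurable_fun setT phi2).
Variables (G : set (set Y)) (D : set Y).
Hypotheses (mG : measurable = <<s G >>) (GI : setI_closed G) (GT : G setT)
  (mD : measurable D) (Dfin : (mu (phi1 @^-1` D) < +oo)%E)
  (Geq : forall A, G A -> mu (phi1 @^-1` (A `&` D)) = mu (phi2 @^-1` (A `&` D))).

Let nu1 : {measure set Y -> \bar R} :=
  measure_function_pushforward__canonical__measure_function_Measure mu mphi1.
Let nu2 : {measure set Y -> \bar R} :=
  measure_function_pushforward__canonical__measure_function_Measure mu mphi2.

Lemma equal_images A : measurable A -> A `<=` D -> nu1 A = nu2 A.
Proof.
move=> mA AD; have : mrestr nu1 mD A = mrestr nu2 mD A.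
  apply: (measure_unique G (fun=> setT)) => //.
  - by rewrite bigcup_const.
  - by move=> k; rewrite /= /mrestr setTI.
by rewrite /mrestr setIidl.
Qed.

Lemma eq_integral_images (E : set Y) (f : Y -> R) : measurable E -> E `<=` D ->
  measurable_fun E f ->
  mu.-integrable (phi1 @^-1` E) (EFin \o (f \o phi1)) ->
  mu.-integrable (phi2 @^-1` E) (EFin \o (f \o phi2)) ->
  \int[mu]_(x in phi1 @^-1` E) f (phi1 x) = \int[mu]_(x in phi2 @^-1` E) f (phi2 x).
Proof.
move=> mE ED mf i1 i2; rewrite /Rintegral; congr fine.
pose h : Y -> \bar R := (EFin \o f) \_ E.
have mh : measurable_fun setT h by apply/(measurable_restrictT _ mE); exact/measurable_EFinP.
have hE (phi : X -> Y) x : x \in phi @^-1` E -> (f (phi x))%:E = (h \o phi) x.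
  by move=> xE; rewrite /h /= patchE -[phi x \in E]/(x \in phi @^-1` E) xE.
have ih (phi : X -> Y) : measurable_fun setT phi ->
    mu.-integrable (phi @^-1` E) (EFin \o (f \o phi)) ->
    mu.-integrable (phi @^-1` E) (h \o phi).
  move=> mphi; apply: eq_integrable => [|x /hE//].
  by rewrite -[X in measurable X]setTI; exact: mphi.
rewrite (eq_integral (h \o phi1)); last by move=> x /hE.
rewrite [RHS](eq_integral (h \o phi2)); last by move=> x /hE.
rewrite -(integral_pushforward mphi1 mh (ih _ mphi1 i1) mE).
rewrite -(integral_pushforward mphi2 mh (ih _ mphi2 i2) mE).
apply: eq_measure_integral => A mA AE.
by apply: equal_images => //; exact: subset_trans ED.
Qed.

End equal_images.

Section predictable_pi_system.
Context {d : measure_display} {T : measurableType d} {R : realType}.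
Variables (P : probability T R) (F : R -> set (set T)).
Hypothesis hF : usual_conditions P F.

Lemma predictable_generatorI : setI_closed (predictable_generator F).
Proof.
have F00 : F 0 set0 by rewrite -[set0](setDv setT); apply: (filtrationD hF) => //; exact: (filtrationT hF).
have G0 : predictable_generator F set0.
  by right; left; exists set0 => //; rewrite setX0.
have zero_itv E E' a b : 0 <= a -> ([set 0] `*` E) `&` (`]a, b]%classic `*` E') = set0 :> set (R * T).
  move=> a0; apply/seteqP; split => // q [/= [-> _] []]; rewrite in_itv/= => /andP[].
  by rewrite ltNge a0.
move=> A B [->|HA]; first by rewrite setTI.
move=> [->|HB]; first by rewrite setIT; right.
case: HA HB => [[E FE ->]|[a [b [E [a0 ab FE ->]]]]] [[E' FE' ->]|[a' [b' [E' [a0' ab' FE' ->]]]]].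
- right; left; exists (E `&` E'); first exact: (filtrationI hF).
  by apply/seteqP; split => [q [/= [-> ?] [_ ?]]|q [/= -> []]].
- by rewrite zero_itv.
- by rewrite setIC zero_itv.
- have E0 := le_trans a0 ab.
  have -> : (`]a, b]%classic `*` E) `&` (`]a', b']%classic `*` E') =
      `]Num.max a a', Num.min b b']%classic `*` (E `&` E') :> set (R * T).
    apply/seteqP; split => q /=; rewrite !in_itv/= gt_max le_min.
      by move=> [[/andP[-> ->] ?] [/andP[-> ->] ?]].
    by move=> [/andP[/andP[-> ->] /andP[-> ->]] []].
  have [mM|Mm] := leP (Num.max a a') (Num.min b b'); last first.
    rewrite (_ : _ `*` _ = set0)//; apply/seteqP; split => // q [/=].
    by rewrite in_itv/= => /andP[/lt_le_trans h /h]; rewrite ltNge (ltW Mm).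
  right; right; exists (Num.max a a'), (Num.min b b'), (E `&` E'); split => //.
    by rewrite le_max a0.
  apply: (filtrationI hF); first by rewrite le_max a0.
    by apply: (filtration_nondecreasing hF a0) FE; rewrite le_max lexx.
  by apply: (filtration_nondecreasing hF a0') FE'; rewrite le_max lexx orbT.
Qed.

End predictable_pi_system.

Section predictable_finite_variation_martingale.
Context {d : measure_display} {T : measurableType d} {R : realType}.
Variables (P : probability T R) (F : R -> set (set T)).
Hypothesis hF : usual_conditions P F.
Variable N : R -> T -> R.
Hypotheses (Nad : adapted F N)
  (Nrc : forall w s, 0 <= s -> N r w @[r --> s^'+] --> N s w)
  (N0 : forall w, N 0 w = 0)
  (Nfv : forall w, finite_variation_path (N ^~ w))
  (Npr : measurable_fun ([set p | 0 <= p.1] : set (predictable_space F)) (fun p : predictable_space F => N p.1 p.2)).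

Let V s w := variation_path (N ^~ w) s.
Let U s w := V s w - N s w.

Let V0 w : V 0 w = 0. Proof. exact: variation_path0. Qed.
Let Vnd w r s : 0 <= r -> r <= s -> V r w <= V s w.
Proof. by move=> *; apply: variation_path_nd. Qed.
Let Vrc w s : 0 <= s -> V r w @[r --> s^'+] --> V s w.
Proof. by move=> s0; apply: variation_path_rc => //; exact: Nrc. Qed.
Let mVF s : 0 <= s -> measurable_wrt (F s) (V s).
Proof. by move=> s0; apply: (measurable_variation hF). Qed.
Let mV s : 0 <= s -> measurable_fun setT (V s).
Proof. by move=> s0; apply: (measurable_wrt_measurable hF s0); exact: mVF. Qed.
Let mN s : 0 <= s -> measurable_fun setT (N s).
Proof. by move=> s0; apply: (measurable_wrt_measurable hF s0); exact: Nad. Qed.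

Let U0 w : U 0 w = 0. Proof. by rewrite /U V0 N0 subr0. Qed.
Let Und w r s : 0 <= r -> r <= s -> U r w <= U s w.
Proof.
move=> r0 rs; have := variation_path_ge (Nfv w) r0 rs.
by rewrite ler_norml => /andP[_]; rewrite /U /V; lra.
Qed.
Let Urc w s : 0 <= s -> U r w @[r --> s^'+] --> U s w.
Proof. by move=> s0; apply: cvgB; [exact: Vrc|exact: Nrc]. Qed.
Let mU s : 0 <= s -> measurable_fun setT (U s).
Proof. by move=> s0; apply: measurable_funB; [exact: mV|exact: mN]. Qed.

Section stopped.
Variables (sigma : T -> \bar R) (st_sigma : stopping_time F sigma).
Hypothesis N_mean0 : forall rho, stopping_time F rho -> (forall w, rho w <= sigma w)%E ->
  forall t, 0 <= t -> P.-integrable setT (EFin \o stopped N rho t) /\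
    (\int[P]_w (stopped N rho t w)%:E = 0)%E.
Variables (k t : R) (k0 : 0 <= k) (t0 : 0 < t).

Let rho w := Order.min (sigma w) (first_passage V k w).

Let st_rho : stopping_time F rho.
Proof. by apply: (stopping_time_min hF) => //; exact: first_passage_stopping. Qed.

Let rho0 w : (0 <= rho w)%E. Proof. by case: st_rho. Qed.

Let rho_sigma w : (rho w <= sigma w)%E. Proof. by rewrite /rho ge_min lexx. Qed.

Let iN s : 0 <= s -> P.-integrable setT (EFin \o stopped N rho s).
Proof. by move=> s0; have [] := N_mean0 st_rho rho_sigma s0. Qed.

Let add_cancel (x y z : \bar R) : x \is a fin_num -> y \is a fin_num -> z \is a fin_num ->
  (0 = x + z)%E -> (0 = y + z)%E -> x = y.
Proof.
by move: x y z => [x| |] [y| |] [z| |]// _ _ _ -[h1] -[h2]; congr (_%:E); lra.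
Qed.

(** The martingale property of the stopped process, from its means at the stopping
    time [rho] and at the one that stops at a on E. *)
Let stopped_event a b E : 0 <= a -> a <= b -> F a E ->
  (\int[P]_(w in E) (stopped N rho a w)%:E = \int[P]_(w in E) (stopped N rho b w)%:E)%E.
Proof.
move=> a0 ab FE; have b0 := le_trans a0 ab.
have mE : measurable E := filtration_measurable hF a0 FE.
pose rho' w := if w \in E then Order.min a%:E (rho w) else rho w.
have st' : stopping_time F rho' by exact: (stopping_time_restrict hF).
have le' w : (rho' w <= sigma w)%E.
  rewrite /rho'; case: ifPn => _ //; apply: le_trans (rho_sigma w).
  by rewrite ge_min lexx orbT.
have [i' z'] := N_mean0 st' le' b0.
have [i z] := N_mean0 st_rho rho_sigma b0.
have split (f : T -> \bar R) : P.-integrable setT f ->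
    (\int[P]_w f w = \int[P]_(w in E) f w + \int[P]_(w in ~` E) f w)%E.
  move=> fi; rewrite -(setUv E) integral_setU//; first exact: measurableC.
  - by rewrite setUv; exact: measurable_int fi.
  - by apply/disj_setPS => w [].
have E1 : (\int[P]_(w in E) (stopped N rho' b w)%:E = \int[P]_(w in E) (stopped N rho a w)%:E)%E.
  apply: eq_integral => w wE; congr (_%:E); rewrite !stoppedE; congr (N _ w).
  apply: EFin_inj; rewrite !clockE//; last by case: st'.
  by rewrite /rho' wE minA; congr (Order.min _ _); rewrite min_r// lee_fin.
have E2 : (\int[P]_(w in ~` E) (stopped N rho' b w)%:E = \int[P]_(w in ~` E) (stopped N rho b w)%:E)%E.
  apply: eq_integral => w; rewrite inE => wE; congr (_%:E); rewrite !stoppedE.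
  by rewrite /clock /rho' memNset.
have := split _ i'; rewrite z' E1 E2; have := split _ i; rewrite z.
have fE (g : T -> \bar R) : P.-integrable setT g -> (\int[P]_(w in E) g w)%E \is a fin_num.
  by move=> gi; apply: integrable_fin_num => //; exact: integrableS gi.
have fC (g : T -> \bar R) : P.-integrable setT g -> (\int[P]_(w in ~` E) g w)%E \is a fin_num.
  by move=> gi; apply: integrable_fin_num => //; [exact: measurableC|apply: integrableS gi => //; exact: measurableC].
move=> h1 h2; exact: (add_cancel (fE _ (iN a0)) (fE _ i) (fC _ i) h2 h1).
Qed.

Let stopped_nd (X : R -> T -> R) : (forall w r s, 0 <= r -> r <= s -> X r w <= X s w) ->
  forall w r s, 0 <= r -> r <= s -> stopped X rho r w <= stopped X rho s w.
Proof.
move=> Xnd w r s r0 rs; rewrite !stoppedE; apply: Xnd; first exact: clock_ge0.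
exact: le_clock.
Qed.

Let stopped0 (X : R -> T -> R) : (forall w, X 0 w = 0) -> forall w, stopped X rho 0 w = 0.
Proof.
move=> X0 w; rewrite stoppedE (_ : clock rho 0 w = 0)//.
by apply/eqP; rewrite eq_le clock_le//= clock_ge0.
Qed.

Let measurable_stoppedX (X : R -> T -> R) : (forall s, 0 <= s -> measurable_fun setT (X s)) ->
  (forall w s, 0 <= s -> X r w @[r --> s^'+] --> X s w) ->
  forall s, 0 <= s -> measurable_fun setT (stopped X rho s).
Proof.
by move=> mX Xrc s s0; apply: (measurable_stopped hF st_rho s0) => //; exact: aeW.
Qed.

Let stopped_clock (X : R -> T -> R) w : stopped X rho (clock rho t w) w = stopped X rho t w.
Proof. by rewrite !stoppedE clock_clock. Qed.

Let iV : P.-integrable setT (EFin \o stopped V rho t).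
Proof.
have i1 : P.-integrable setT (fun w => (2 * k)%:E + `|(stopped N rho t w)%:E|)%E.
  apply: integrableD => //; last exact: integrable_abse (iN (ltW t0)).
  exact: finite_measure_integrable_cst.
apply: le_integrable i1 => //.
  by apply/measurable_EFinP; apply: measurable_stoppedX (ltW t0).
move=> w _ /=; have c0 := clock_ge0 (ltW t0) (rho0 w).
rewrite !lee_fin stoppedE ger0_norm; last by rewrite -(V0 w) Vnd.
rewrite ger0_norm; last by rewrite addr_ge0// mulr_ge0.
apply: variation_overshoot => //; first exact: Nrc.
move=> r r0 rc; rewrite ltNge -(first_passage_leE Vnd Vrc k w r0) -ltNge.
apply: (@lt_le_trans _ _ (clock rho t w)%:E); first by rewrite lte_fin.
by rewrite clockE// ge_min /rho ge_min lexx !orbT.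
Qed.

Let iU : P.-integrable setT (EFin \o stopped U rho t).
Proof.
rewrite (_ : EFin \o _ = (EFin \o stopped V rho t) \- (EFin \o stopped N rho t))%E//.
by apply: integrableB => //; exact: iN (ltW t0).
Qed.

Let mu := (P \x (@lebesgue_measure R))%E.
Let W1 := stopped V rho.
Let W2 := stopped U rho.
Let phi1 := time_change F W1 t.
Let phi2 := time_change F W2 t.

Let W1_0 := stopped0 V0.
Let W2_0 := stopped0 U0.
Let W1_nd := stopped_nd Vnd.
Let W2_nd := stopped_nd Und.
Let W1_rc w := stopped_rc (rho0 w) (@Vrc w).
Let W2_rc w := stopped_rc (rho0 w) (@Urc w).
Let mW1 := measurable_stoppedX mV Vrc.
Let mW2 := measurable_stoppedX mU Urc.

Let integrable_le_final (W : R -> T -> R) (Z : T -> R) a b :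
  (forall w, W 0 w = 0) -> (forall w r s, 0 <= r -> r <= s -> W r w <= W s w) ->
  (forall s, 0 <= s -> measurable_fun setT (W s)) -> P.-integrable setT (EFin \o W t) ->
  measurable_fun setT Z -> (forall w, `|Z w| <= 1) -> 0 <= a -> a <= b -> b <= t ->
  P.-integrable setT (EFin \o (fun w => Z w * (W b w - W a w))).
Proof.
move=> W0 Wnd mW iW mZ Z1 a0 ab bt; have b0 := le_trans a0 ab.
apply: le_integrable iW => //.
  by apply/measurable_EFinP; apply: measurable_funM => //; apply: measurable_funB; exact: mW.
move=> w _; rewrite /= lee_fin normrM -[leRHS]mul1r ler_pM//.
have Wa : 0 <= W a w by rewrite -(W0 w) Wnd.
have Wb := Wnd w _ _ a0 ab; have Wt := Wnd w _ _ b0 bt.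
by rewrite !ger0_norm; lra.
Qed.

Let equal_increments a b E : 0 <= a -> a <= b -> b <= t -> F a E ->
  (\int[P]_(w in E) (W1 b w - W1 a w)%:E = \int[P]_(w in E) (W2 b w - W2 a w)%:E)%E.
Proof.
move=> a0 ab bt FE; have b0 := le_trans a0 ab.
have mE : measurable E := filtration_measurable hF a0 FE.
have i1 : P.-integrable E (fun w => (W1 b w - W1 a w)%:E).
  apply: (@integrableS _ _ _ _ setT) => //.
  have one_le w : `|(cst 1 : T -> R) w| <= 1 by rewrite /= normr1.
  have := integrable_le_final W1_0 W1_nd mW1 iV (measurable_cst (1 : R)) one_le a0 ab bt.
  rewrite (_ : (fun w => cst 1 w * (W1 b w - W1 a w)) = (fun w => W1 b w - W1 a w))//.
  by apply/funext => w; rewrite mul1r.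
have iNE s : 0 <= s -> P.-integrable E (EFin \o stopped N rho s).
  by move=> s0; apply: integrableS (iN s0).
have -> : (\int[P]_(w in E) (W2 b w - W2 a w)%:E =
  \int[P]_(w in E) ((W1 b w - W1 a w)%:E - ((stopped N rho b w)%:E - (stopped N rho a w)%:E)))%E.
  apply: eq_integral => w _; rewrite -!EFinB; congr (_%:E).
  by rewrite /W1 /W2 !stoppedE /U; ring.
rewrite integralB//; last by apply: integrableB => //; exact: iNE.
rewrite [X in (_ - X)%E]integralB//; [|exact: iNE..].
rewrite (stopped_event a0 ab FE) subee ?sube0//.
by apply: integrable_fin_num => //; exact: iNE.
Qed.

Let D0 : set (predictable_space F) := `]0, t]%classic `*` setT.

Let equal_rectangles a b E : 0 <= a -> a <= b -> b <= t -> F a E ->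
  mu (phi1 @^-1` (`]a, b] `*` E)) = mu (phi2 @^-1` (`]a, b] `*` E)).
Proof.
move=> a0 ab bt FE; have mE : measurable E := filtration_measurable hF a0 FE.
have at_ := le_trans ab bt.
rewrite /phi1 /phi2.
rewrite (time_change_preimage F (ltW t0) W1_0 W1_nd W1_rc E a0 ab).
rewrite (time_change_preimage F (ltW t0) W2_0 W2_nd W2_rc E a0 ab).
rewrite (min_l at_) (min_l bt); have e1 := strip_measure P W1_nd a0 ab mE.
have e2 := strip_measure P W2_nd a0 ab mE.
etransitivity; first exact: e1.
by etransitivity; last exact: (esym e2); exact: equal_increments.
Qed.

Let equal_generators A : predictable_generator F A ->
  mu (phi1 @^-1` (A `&` D0)) = mu (phi2 @^-1` (A `&` D0)).
Proof.
move=> [->|[[E FE ->]|[a [b [E [a0 ab FE ->]]]]]].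
- rewrite setTI; apply: equal_rectangles => //; [exact: ltW|exact: (filtrationT hF)].
- rewrite (_ : _ `&` _ = set0) ?preimage_set0 ?measure0//.
  apply/seteqP; split => // q [[/= q0 _] []]; rewrite /= q0 in_itv/= ltxx.
  by [].
- have -> : (`]a, b]%classic `*` E) `&` D0 = `]a, Num.min b t]%classic `*` E.
    apply/seteqP; split => q; rewrite /D0 /= !in_itv/= le_min.
      by move=> [[/andP[-> ->] ?] [/andP[_ ->] _]].
    by move=> [/andP[aq /andP[-> ->]] ?]; rewrite aq (le_lt_trans a0 aq).
  have [am|ma] := leP a (Num.min b t).
    by apply: equal_rectangles => //; rewrite ge_min lexx orbT.
  rewrite (_ : _ `*` _ = set0) ?preimage_set0 ?measure0//.
  apply/seteqP; split => // q [/=]; rewrite in_itv/= => /andP[/lt_le_trans h /h].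
  by rewrite ltNge (ltW ma).
Qed.

Let stopped_V_clock w : W1 (clock rho t w) w = W1 t w := stopped_clock V w.
Let stopped_U_clock w : W2 (clock rho t w) w = W2 t w := stopped_clock U w.

Let equal_step_integrals n j : (j < n.+1)%N ->
  \int[mu]_(p in strip W1 (grid t n j) (grid t n j.+1)) step_quotient N t n j (phi1 p) =
  \int[mu]_(p in strip W2 (grid t n j) (grid t n j.+1)) step_quotient N t n j (phi2 p).
Proof.
move=> jn.
have e1 : phi1 @^-1` time_cell t n j = _ := time_cell_preimage F t0 W1_0 W1_nd W1_rc jn.
have e2 : phi2 @^-1` time_cell t n j = _ := time_cell_preimage F t0 W2_0 W2_nd W2_rc jn.
have i1 := integrable_step_quotient hF Nad Npr t0 W1_0 W1_nd W1_rc mW1 iV jn.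
have i2 := integrable_step_quotient hF Nad Npr t0 W2_0 W2_nd W2_rc mW2 iU jn.
rewrite -e1 -e2.
apply: (@eq_integral_images _ _ _ (predictable_space F) R mu phi1 phi2 _ _ (predictable_generator F) D0) => //.
- by apply: (measurable_time_change hF) => //; exact: ltW.
- by apply: (measurable_time_change hF) => //; exact: ltW.
- exact: (predictable_generatorI hF).
- by left.
- by apply: measurable_rectangle => //; [exact: ltW|exact: (filtrationT hF)].
- rewrite /phi1 (time_change_preimage F (ltW t0) W1_0 W1_nd W1_rc setT (lexx 0) (ltW t0)).
  rewrite (min_l (ltW t0)) minxx.
  rewrite [X in (X < _)%E](strip_measure P W1_nd (lexx 0) (ltW t0) measurableT).
  under eq_integral do rewrite W1_0 subr0.
  by move/integrable_fin_num : iV => /(_ measurableT); rewrite fin_numElt => /andP[].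
- exact: (measurable_time_cell hF t0).
- move=> q [/=]; rewrite !in_itv/= => /andP[gq qg] _; split => //=; rewrite in_itv/=.
  rewrite (le_lt_trans (grid_ge0 n j (ltW t0)) gq)/= (le_trans qg)//.
  by rewrite -[leRHS](gridn t n) le_grid// ltW.
- exact: (measurable_step_quotient hF).
- by rewrite e1.
- by rewrite e2.
Qed.

Let bump_bounded (Y : T -> R) : measurable_fun setT Y ->
  P.-integrable setT (EFin \o (fun w => bump (Y w))).
Proof.
move=> mY; apply: (@le_integrable _ _ _ _ _ measurableT _ (cst 1%:E)) => //.
- by apply/measurable_EFinP; apply: (measurableT_comp measurable_bump).
- by move=> w _; rewrite /= lee_fin normr1 ger0_norm ?bump_le1 ?bump_ge0.
- exact: finite_measure_integrable_cst.
Qed.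

Let mstopN s : 0 <= s -> measurable_fun setT (stopped N rho s).
Proof. exact: measurable_stoppedX. Qed.

Let bump_increment n j : (j < n.+1)%N ->
  \int[P]_w (stopped_quotient N rho t n j w * (W1 (grid t n j.+1) w - W1 (grid t n j) w)) -
  \int[P]_w (stopped_quotient N rho t n j w * (W2 (grid t n j.+1) w - W2 (grid t n j) w)) =
  \int[P]_w bump (stopped N rho (grid t n j.+1) w) - \int[P]_w bump (stopped N rho (grid t n j) w).
Proof.
move=> jn; have g0 := grid_ge0 n j (ltW t0); have g1 := grid_ge0 n j.+1 (ltW t0).
have gg : grid t n j <= grid t n j.+1 by apply: le_grid (ltW t0) _ _ _.
have gt : grid t n j.+1 <= t by rewrite -[leRHS](gridn t n) le_grid// ltW.
have mZ : measurable_fun setT (stopped_quotient N rho t n j).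
  by apply: measurable_bump_quotient; exact: mstopN.
have Z1 w : `|stopped_quotient N rho t n j w| <= 1 by exact: bump_quotient_le1.
rewrite -RintegralB//; last first.
- exact: (integrable_le_final W2_0 W2_nd mW2 iU mZ Z1 g0 gg gt).
- exact: (integrable_le_final W1_0 W1_nd mW1 iV mZ Z1 g0 gg gt).
rewrite -RintegralB//; [|exact: bump_bounded (mstopN g1)|exact: bump_bounded (mstopN g0)].
apply: eq_Rintegral => w _; rewrite bump_quotientE /stopped_quotient -mulrBr.
by congr (_ * _); rewrite /W1 /W2 !stoppedE /U; ring.
Qed.

Let const_diff_cvg0 (u v : R^nat) (c : R) : u n @[n --> \oo] --> 0 ->
  v n @[n --> \oo] --> 0 -> (forall n, u n - v n = c) -> c = 0.
Proof.
move=> u0 v0 uvc; have : u n - v n @[n --> \oo] --> (0 - 0 : R) by exact: cvgB.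
rewrite subrr (_ : (fun n => u n - v n) = cst c); last exact/funext.
by move/cvg_lim => <- //; rewrite lim_cst.
Qed.

(** The means of the increments of [bump] telescope.  Each of them is the difference
    of the integrals against dV dP and dU dP, and so are the predictable
    approximations, for which this difference is 0. *)
Lemma integral_bump_stopped : \int[P]_w bump (stopped N rho t w) = 0.
Proof.
have h1 := chain_rule_approximation hF Nad Nrc Npr st_rho t0 W1_0 W1_nd W1_rc mW1 iV stopped_V_clock.
have h2 := chain_rule_approximation hF Nad Nrc Npr st_rho t0 W2_0 W2_nd W2_rc mW2 iU stopped_U_clock.
apply: (const_diff_cvg0 h1 h2) => n; rewrite -sumrB.
pose B j := \int[P]_w bump (stopped N rho (grid t n j) w).
transitivity (\sum_(j < n.+1) (B j.+1 - B j)).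
  apply: eq_bigr => j _; rewrite /B -bump_increment//.
  by rewrite [X in _ - X - _](equal_step_integrals (ltn_ord j)); lra.
rewrite -(big_mkord xpredT (fun j => B j.+1 - B j)) telescope_sumr// /B gridn grid0.
rewrite [X in _ - X](_ : _ = 0) ?subr0// /Rintegral.
by rewrite integral0_eq// => w _; rewrite (stopped0 N0) bump0.
Qed.

Lemma stopped_null : \forall w \ae P, stopped N rho t w = 0.
Proof.
have mb : measurable_fun setT (fun w => bump (stopped N rho t w)).
  by apply: (measurableT_comp measurable_bump); exact: mstopN (ltW t0).
have ib := bump_bounded (mstopN (ltW t0)).
have h := integral_bump_stopped.
have : (\int[P]_w `|(bump (stopped N rho t w))%:E| = 0)%E.
  rewrite -[0%E]/(0%:E) -h /Rintegral fineK; last by apply: integrable_fin_num.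
  by apply: eq_integral => w _ /=; rewrite ger0_norm ?bump_ge0.
move/(ae_eq_integral_abs P measurableT).
move=> /(_ ((measurable_EFinP _ _).2 mb)).
by apply: filterS => w /(_ I) [] /bump_eq0.
Qed.

End stopped.
End predictable_finite_variation_martingale.

Section null_local_martingale.
Context {d : measure_display} {T : measurableType d} {R : realType}.
Variables (P : probability T R) (F : R -> set (set T)).
Hypothesis hF : usual_conditions P F.

(** For each w the localizing times eventually exceed any given rational time q, and
    so do the first passage times, since the variation of N up to q is finite.  So
    N vanishes at rational times, and everywhere by right-continuity. *)
Lemma predictable_finite_variation_null (N : R -> T -> R) (sigma : nat -> T -> \bar R) :
  adapted F N ->
  (forall w s, 0 <= s -> N r w @[r --> s^'+] --> N s w) ->
  (forall w, N 0 w = 0) ->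
  (forall w, finite_variation_path (N ^~ w)) ->
  measurable_fun ([set p | 0 <= p.1] : set (predictable_space F)) (fun p : predictable_space F => N p.1 p.2) ->
  (forall n, stopping_time F (sigma n)) ->
  (\forall w \ae P, forall t, \forall n \near \oo, (t%:E <= sigma n w)%E) ->
  (forall n rho, stopping_time F rho -> (forall w, rho w <= sigma n w)%E ->
    forall t, 0 <= t -> P.-integrable setT (EFin \o stopped N rho t) /\
      (\int[P]_w (stopped N rho t w)%:E = 0)%E) ->
  \forall w \ae P, forall t, 0 <= t -> N t w = 0.
Proof.
move=> Nad Nrc N0 Nfv Npr st_sigma sigmay mean0.
pose V s w := variation_path (N ^~ w) s.
pose rho n w := Order.min (sigma n w) (first_passage V n%:R w).
have null n m : \forall w \ae P, if unpickle m is Some q then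
    0 < ratr q :> R -> stopped N (rho n) (ratr q) w = 0 else True.
  case: (unpickle m) => [q|]; last exact: aeW.
  have [q0|] := ltP 0 (ratr q : R); last by move=> _; exact: aeW.
  have := stopped_null hF Nad Nrc N0 Nfv Npr (st_sigma n) (mean0 n) (ler0n R n) q0.
  by apply: filterS => w h _.
have {}null : \forall w \ae P, forall n m, if unpickle m is Some q then
    0 < ratr q :> R -> stopped N (rho n) (ratr q) w = 0 else True.
  by apply: ae_foralln => n; apply: ae_foralln => m; exact: null.
apply: filterS2 sigmay null => w sy null.
have rat0 (q : rat) : 0 < ratr q :> R -> N (ratr q) w = 0.
  move=> q0; pose B := Num.bound `|V (ratr q) w|.
  have [n [Bn sn]] : exists n, (B <= n)%N /\ ((ratr q)%:E <= sigma n w)%E.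
    have : \forall n \near \oo, (B <= n)%N /\ ((ratr q)%:E <= sigma n w)%E.
      near=> n; split; near: n; [exact: nbhs_infty_ge|exact: sy].
    by move=> [n _ /(_ n (leqnn n))]; exists n.
  have := null n (pickle q); rewrite pickleK => /(_ q0) <-.
  rewrite stoppedE; congr (N _ w); apply/esym/EFin_inj.
  have Vnd w' r s : 0 <= r -> r <= s -> V r w' <= V s w'.
    by move=> *; apply: variation_path_nd.
  have Vrc w' s : 0 <= s -> V r w' @[r --> s^'+] --> V s w'.
    by move=> s0; apply: variation_path_rc => //; exact: Nrc.
  have fp : ((ratr q)%:E <= first_passage V n%:R w)%E.
    rewrite leNgt; apply/negP => /ltW; rewrite (first_passage_leE Vnd Vrc _ _ (ltW q0)).
    apply/negP; rewrite -ltNge; apply: le_lt_trans (ler_norm _) _.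
    by apply: lt_le_trans (archi_boundP (normr_ge0 _)) _; rewrite ler_nat.
  have rq : ((ratr q)%:E <= rho n w)%E by rewrite /rho le_min sn fp.
  rewrite clockE; first by rewrite min_l.
  by apply: le_trans rq; rewrite lee_fin ltW.
move=> t t0; apply/eqP; apply: contraT => Nt.
have nN0 : 0 < `|N t w| by rewrite normr_gt0.
move/cvgrPdist_lt : (Nrc w t t0) => /(_ _ nN0)[/= e e0 Ne].
have : t < t + e by rewrite ltrDl.
move=> /rat_in_itvoo[q]; rewrite in_itv/= => /andP[tq qe].
have := Ne (ratr q); rewrite /= distrC ger0_norm ?subr_ge0 ?(ltW tq)// ltrBlDl => /(_ qe tq).
by rewrite rat0 ?subr0 ?ltxx// (le_lt_trans t0).
Unshelve. all: by end_near. Qed.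

(** The predictable sigma-algebra on [0, +oo[ x T is the trace of the one on
    R * T. *)
Lemma predictable_measurable (A : R -> T -> R) : predictable F A ->
  measurable_fun ([set p | 0 <= p.1] : set (predictable_space F)) (fun p : predictable_space F => A p.1 p.2).
Proof.
move=> pA _ B mB; pose D : set (R * T) := `[0, +oo[ `*` setT.
have DE : [set p | 0 <= p.1] = D.
  by apply/seteqP; split => p; rewrite /D /= in_itv/= andbT => // -[].
have mD : measurable (D : set (predictable_space F)) by rewrite -DE; exact: (measurable_nonneg_time hF).
rewrite DE; apply: (@smallest_sub _ (sigma_algebra D) _ _ _ _ _ (pA B mB)).
- split => [|C mC|C mC]; first exact: measurable0.
    exact: measurableD.
  exact: bigcupT_measurable.
- by move=> Q FQ; apply: sub_sigma_algebra; right.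
Qed.

(** M itself need not start at 0 for every w, hence a version of the stopped variable
    rather than the variable itself. *)
Lemma local_martingale_stopped_mean (M : R -> T -> R) (tau rho : T -> \bar R) t :
  (\forall w \ae P, cadlag_path (M ^~ w)) -> (\forall w \ae P, M 0 w = 0) ->
  stopping_time F tau -> stopping_time F rho -> (forall w, rho w <= tau w)%E -> 0 <= t ->
  martingale P F (stopped (fun t w => M t w - M 0 w) tau) ->
  exists2 Y : T -> R, (\forall w \ae P, Y w = stopped M rho t w) &
    P.-integrable setT (EFin \o Y) /\ (\int[P]_w (Y w)%:E = 0)%E.
Proof.
move=> Mcad M0 [tau0 _] /[dup] st_rho [rho0 _] rho_tau t0 mart.
set L := stopped _ tau in mart.
have Lrc : \forall w \ae P, forall s, 0 <= s -> L r w @[r --> s^'+] --> L s w.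
  apply: filterS Mcad => w [Mr _]; apply: (stopped_rc (tau0 w)) => s s0.
  by apply: cvgB; [exact: Mr|exact: cvg_cst].
exists (stopped L rho t); last split.
- apply: filterS M0 => w M0w; rewrite !stoppedE /L stoppedE M0w subr0; congr (M _ w).
  apply: EFin_inj; rewrite clockE// min_l// clockE//.
  by apply: le_trans (rho_tau w); rewrite ge_min lexx orbT.
- exact: (integrable_optional_stopping hF mart t0 Lrc st_rho).
- rewrite (optional_stopping hF mart t0 Lrc st_rho).
  have [_ _ /(_ 0 t (lexx 0) t0)[_ _ /(_ _ (filtrationT hF (lexx 0))) <-]] := mart.
  apply: integral0_eq => w _; rewrite /L stoppedE.
  rewrite (_ : clock tau 0 w = 0) ?subrr//.
  by apply/eqP; rewrite eq_le clock_le//= clock_ge0.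
Qed.

Lemma ae_eq_integrable (X Y : T -> R) : (\forall w \ae P, Y w = X w) ->
  measurable_fun setT X -> P.-integrable setT (EFin \o Y) ->
  P.-integrable setT (EFin \o X) /\ (\int[P]_w (X w)%:E = \int[P]_w (Y w)%:E)%E.
Proof.
move=> YX mX iY; have mY := measurable_int _ iY.
have mX' : measurable_fun setT (EFin \o X) by exact/measurable_EFinP.
split; last first.
  by apply: ae_eq_integral => //; apply: filterS YX => w YXw _ /=; rewrite YXw.
apply/integrableP; split => //; have /integrableP[_] := iY; apply: le_lt_trans.
rewrite le_eqVlt; apply/orP; left; apply/eqP; apply: ae_eq_integral => //.
- exact: measurableT_comp.
- exact: measurableT_comp.
- by apply: filterS YX => w YXw _ /=; rewrite YXw.
Qed.

(** The event that all paths behave is in F_0 by completeness, so N can be set to 0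
    off this event without losing adaptedness or predictability. *)
Lemma decomposition_unique (X M A M' A' : R -> T -> R) :
  decomposition P F X M A -> decomposition P F X M' A' ->
  \forall w \ae P, forall t, 0 <= t -> A t w = A' t w.
Proof.
move=> [XMA [Mad Mcad [tau [st_tau tau_nd tauy Mmart]]] M0 Aad Acad Apr Afv A0].
move=> [XMA' [Mad' Mcad' [tau' [st_tau' tau_nd' tauy' Mmart']]] M0' Aad' Acad' Apr' Afv' A0'].
pose good : set T := [set w | [/\ [/\ cadlag_path (A ^~ w) & cadlag_path (A' ^~ w)],
  [/\ finite_variation_path (A ^~ w) & finite_variation_path (A' ^~ w)],
  A 0 w = 0 /\ A' 0 w = 0 &
  (forall t, 0 <= t -> X t w = M t w + A t w) /\ (forall t, 0 <= t -> X t w = M' t w + A' t w)]].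
have ae_good : \forall w \ae P, good w.
  near=> w; split; split; near: w.
  - exact: Acad.
  - exact: Acad'.
  - exact: Afv.
  - exact: Afv'.
  - by apply: filterS A0 => w [].
  - by apply: filterS A0' => w [].
  - exact: XMA.
  - exact: XMA'.
have Fgood t : 0 <= t -> F t good.
  move=> t0; rewrite -[good]setCK; apply: (filtrationC hF) => //.
  exact: (filtration_negligible hF).
pose N s w := \1_good w * (A' s w - A s w) : R.
have NE s w : good w -> N s w = A' s w - A s w.
  by move=> gw; rewrite /N indicE mem_set// mul1r.
have N_bad s w : ~ good w -> N s w = 0.
  by move=> gw; rewrite /N indicE memNset// mul0r.
have goodP w (Q : (R -> R) -> Prop) : (good w -> Q (fun s => A' s w - A s w)) ->
    Q (fun=> 0) -> Q (N ^~ w).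
  move=> Qg Q0; have [gw|ngw] := pselect (good w).
    by rewrite (_ : N ^~ w = fun s => A' s w - A s w); [exact: Qg|apply/funext => s; rewrite NE].
  by rewrite (_ : N ^~ w = fun=> 0)//; apply/funext => s; rewrite N_bad.
have Nad : adapted F N.
  move=> t t0; apply/(measurable_wrtP hF _ t0); apply: measurable_funM.
    by apply: measurable_indic; apply/(filtration_spaceP hF _ t0); exact: Fgood.
  by apply: measurable_funB; apply/(measurable_wrtP hF _ t0); [exact: Aad'|exact: Aad].
have Nrc w s : 0 <= s -> N r w @[r --> s^'+] --> N s w.
  move=> s0; apply: (goodP w (fun x => x r @[r --> s^'+] --> x s)); last exact: cvg_cst.
  by move=> [[[Ar _] [Ar' _]] _ _ _]; apply: cvgB; [exact: Ar'|exact: Ar].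
have N0 w : N 0 w = 0.
  by apply: (goodP w (fun x => x 0 = 0)) => // -[_ _ [-> ->] _]; rewrite subrr.
have Nfv w : finite_variation_path (N ^~ w).
  apply: (goodP w (@finite_variation_path R)) => [[_ [fA fA'] _ _] t|t].
    rewrite le_eqVlt => /predU1P[<-|t0]; first exact: bounded_variationxx.
    apply: (bounded_variationD t0 (fA' t (ltW t0))).
    exact: bounded_variationN (fA t (ltW t0)).
  by move=> t0; exact: nondecreasing_bounded_variation.
have Npr : measurable_fun ([set p | 0 <= p.1] : set (predictable_space F)) (fun p : predictable_space F => N p.1 p.2).
  apply: measurable_funM; last first.
    by apply: measurable_funB; exact: predictable_measurable.
  have mg : measurable ([set p | 0 <= p.1 /\ good p.2] : set (predictable_space F)).
    by apply: measurable_nonneg_event; exact: Fgood.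
  have mi : measurable_fun ([set p | 0 <= p.1] : set (predictable_space F))
      (\1_([set p | 0 <= p.1 /\ good p.2] : set (predictable_space F)) : predictable_space F -> R).
    exact: measurable_indic.
  apply: eq_measurable_fun mi => p; rewrite inE /= => p0; rewrite !indicE.
  congr (_%:R); congr nat_of_bool; apply/idP/idP; rewrite !inE; first by case.
  by split.
pose sigma n w := Order.min (tau n w) (tau' n w).
have st_sigma n : stopping_time F (sigma n) by exact: (stopping_time_min hF).
have sigmay : \forall w \ae P, forall t, \forall n \near \oo, (t%:E <= sigma n w)%E.
  apply: filterS2 tauy tauy' => w ty ty' t; near=> n; rewrite /sigma le_min.
  apply/andP; split; near: n.
    by move/cvgeyPge : ty; exact.
  by move/cvgeyPge : ty'; exact.
have mean0 n rho : stopping_time F rho -> (forall w, rho w <= sigma n w)%E ->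
    forall t, 0 <= t -> P.-integrable setT (EFin \o stopped N rho t) /\
      (\int[P]_w (stopped N rho t w)%:E = 0)%E.
  move=> st_rho rho_sigma t t0.
  have [rt rt'] : (forall w, rho w <= tau n w)%E /\ (forall w, rho w <= tau' n w)%E.
    by split=> w; apply: le_trans (rho_sigma w) _; rewrite ge_min lexx ?orbT.
  have [Y YM [iY Y0]] := local_martingale_stopped_mean Mcad M0 (st_tau n) st_rho rt t0 (Mmart n).
  have [Y' YM' [iY' Y0']] := local_martingale_stopped_mean Mcad' M0' (st_tau' n) st_rho rt' t0 (Mmart' n).
  have iD : P.-integrable setT (EFin \o (Y \- Y')).
    by rewrite (_ : EFin \o _ = (EFin \o Y) \- (EFin \o Y'))%E//; exact: integrableB.
  have YN : \forall w \ae P, (Y \- Y') w = stopped N rho t w.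
    apply: filterS3 YM YM' ae_good => w Yw Yw' gw; rewrite /= Yw Yw' !stoppedE NE//.
    have c0 : 0 <= clock rho t w by apply: clock_ge0 => //; case: st_rho.
    have [_ _ _ [/(_ _ c0) e1 /(_ _ c0) e2]] := gw.
    by move: e1 e2; lra.
  have mN : measurable_fun setT (stopped N rho t).
    apply: (measurable_stopped hF st_rho t0); last by apply: aeW => w s; exact: Nrc.
    by move=> s s0; apply: (measurable_wrt_measurable hF s0); exact: Nad.
  have [iN eN] := ae_eq_integrable YN mN iD; split => //; rewrite eN.
  under eq_integral do rewrite /= EFinB.
  by rewrite integralB//= Y0 Y0' sube0.
have := predictable_finite_variation_null Nad Nrc N0 Nfv Npr st_sigma sigmay mean0.
apply: filterS2 ae_good => w gw Nw t t0.
by have := Nw t t0; rewrite NE// => /eqP; rewrite subr_eq0 => /eqP.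
Unshelve. all: by end_near. Qed.

End null_local_martingale.

(** * The two descriptions of the class *)

Unset Implicit Arguments.

Theorem corollary2 (d : measure_display) (T : measurableType d) (R : realType)
    (P : probability T R) (F : R -> set (set T)) (hF : usual_conditions P F)
    (X M A : R -> T -> R) (hX : cadlag P X) (hXMA : decomposition P F X M A) :
  class_Sigma_r P F X <->
  exists C V : R -> T -> R,
    [/\ adapted F C /\ continuous_process P C /\ finite_variation P C,
        cadlag P V /\ predictable F V /\ finite_variation P V,
        \forall w \ae P, forall t, 0 <= t -> A t w = C t w + V t w &
        \forall w \ae P, forall t, 0 <= t ->
          stieltjes_integral \1_[set s | X s w != 0] (C ^~ w) t = 0 /\
          stieltjes_integral \1_[set s | left_limit (X ^~ w) s != 0]
            (V ^~ w) t = 0].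
Proof.
split.
- move=> [M' [A' [hXMA' A'0]]]; exists (fun _ _ => 0), A.
  have AA' := decomposition_unique hF hXMA hXMA'.
  split.
  + split; [|split].
    * move=> t t0; apply/(measurable_wrtP hF _ t0); exact: measurable_cst.
    * by apply: aeW => w; exact: cst_continuous.
    * by apply: aeW => w t t0; exact: nondecreasing_bounded_variation.
  + by case: hXMA.
  + by apply: aeW => w t t0; rewrite add0r.
  + apply: filterS2 AA' A'0 => w Aw A'w t t0; split; first exact: stieltjes_integral0.
    by rewrite (eq_stieltjes_integral _ _ Aw) A'w.
- move=> [C [V [[_ [Cc Cfv]] [Vcad [_ Vfv]] ACV CV0]]]; exists M, A; split => //.
  have [_ _ _ _ Acad _ Afv _] := hXMA.
  near=> w.
  have Xw : cadlag_path (X ^~ w) by near: w; exact: hX.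
  have Cw : continuous_path (C ^~ w) by near: w; exact: Cc.
  have Cfw : finite_variation_path (C ^~ w) by near: w; exact: Cfv.
  have [Vr _] : cadlag_path (V ^~ w) by near: w; exact: Vcad.
  have Vfw : finite_variation_path (V ^~ w) by near: w; exact: Vfv.
  have [Ar _] : cadlag_path (A ^~ w) by near: w; exact: Acad.
  have Afw : finite_variation_path (A ^~ w) by near: w; exact: Afv.
  have ACVw : forall t, 0 <= t -> A t w = C t w + V t w by near: w; exact: ACV.
  have CV0w : forall t, 0 <= t ->
    stieltjes_integral \1_[set s | X s w != 0] (C ^~ w) t = 0 /\
    stieltjes_integral \1_[set s | left_limit (X ^~ w) s != 0] (V ^~ w) t = 0.
    by near: w; exact: CV0.
  move=> t t0; have [C0 V0] := CV0w t t0.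
  have Cr s : 0 <= s -> C u w @[u --> s^'+] --> C s w by exact: continuous_path_right.
  rewrite (stieltjes_integral_indicD Ar Afw Cr Cfw Vr Vfw ACVw t0).
    by rewrite V0 addr0 stieltjes_integral_left_limit.
  exact: left_limit_ne0_measurable.
Unshelve. all: by end_near. Qed.
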